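(* Let $m>0$ and let $H_0$ be the free Dirac operator in $L^2(\mathbb{R}_+)\oplus L^2(\mathbb{R}_+)$ with Dirichlet boundary condition, $H_0f=\begin{pmatrix} mf_1-f_2'\\ f_1'-mf_2\end{pmatrix}$, $f_1(0)=0$. Then $H_0$ has only one state: the simple virtual state at $\lambda=-m$.
   Context: $\mathbb{R}_+=[0,\infty)$, $\mathbb{C}_\pm=\{\pm\operatorname{Im}\lambda>0\}$. $H_0$ is self-adjoint with spectrum $\sigma_{\rm ac}(H_0)=\mathbb{R}\setminus(-m,m)$. The cut plane. Let $\Lambda=\mathbb{C}\setminus[-m,m]$ and $k(\lambda)=\sqrt{\lambda^2-m^2}$ on $\Lambda$, with the branch $k(\lambda)=\lambda+O(1/\lambda)$ as $|\lambda|\to\infty$ (so $\operatorname{Im}k>0$ on $\mathbb{C}_+$). Let $g_+$, $g_-$ be the upper and lower rims of the cut $(-m,m)$ in $\mathbb{C}\setminus[-m,m]$, and $\Lambda_\pm=\mathbb{C}_\pm\cup g_\pm$. $\Lambda_+$ represents the physical sheet and $\Lambda_-$ the non-physical sheet of the two-sheeted Riemann surface of $\sqrt{\lambda^2-m^2}$. Functions are first defined on $\mathbb{C}_+$ and then continued analytically (meromorphically) into $\Lambda$ through $\sigma_{\rm ac}(H_0)$, up to and including the rims $g_\pm$, where they are regarded as functions near the corresponding points of the Riemann surface. States. For an operator $H$ ($=H_0$ here) and $h\in C_0(\mathbb{R}_+,\mathbb{C}^2)$ (continuous, compactly supported), the function $G(\lambda)=((H-\lambda)^{-1}h,h)$,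 $\lambda\in\mathbb{C}_+$, has a meromorphic continuation from $\mathbb{C}_+$ into $\Lambda$ through $\sigma_{\rm ac}(H_0)$. 1) $\lambda_0\in g_+$ is an eigenvalue if $G$ has a pole at $\lambda_0$ for some $h\neq0$. 2) $\lambda_0\in\Lambda_-$ is a resonance if $G$ has a pole at $\lambda_0$ for some $h\ne0$; if moreover $\lambda_0\in g_-$, it is called an anti-bound state. 3) $\lambda_0=m$ or $\lambda_0=-m$ is a virtual state if, for some $h\neq 0$, the function $z\mapsto G(\lambda_0+z^2)$ has a pole at $z=0$. 4) A state is an eigenvalue, a resonance or a virtual state. Its multiplicity is the multiplicity of the corresponding pole (the largest order attained over $h$); it is simple if the pole is simple. *)

(* Defs.v *)
From HB Require Import structures.
From mathcomp Require Import all_boot all_order all_algebra.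
From mathcomp Require Import all_classical all_reals all_analysis.
From mathcomp Require Import complex.
Set Implicit Arguments.
Unset Strict Implicit.
Unset Printing Implicit Defensive.
Import Order.TTheory GRing.Theory Num.Theory.
Import numFieldNormedType.Exports.
Local Open Scope classical_set_scope.
Local Open Scope complex_scope.
Local Open Scope ring_scope.

(* [R[i]^o] is [R[i]] carrying the topology of a normed module over itself. *)

(* Unqualified [Re] and [Im] are the ssrnum projections of a closed field into
   itself; the real-valued projections are wanted here. *)
Local Notation Re := complex.Re.
Local Notation Im := complex.Im.

Section Analytic.
Context {R : realType}.
Local Notation C := (R[i]^o).

Definition analytic_at (f : C -> C) (p : C) : Prop :=
  exists a : nat -> C,
    \forall w \near p, series (fun k => a k * (w - p) ^+ k) @ \oo --> f w.

(* The value of [F] at the point [p] itself is irrelevant. *)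
Definition meromorphic_at (F : C -> C) (p : C) : Prop :=
  exists (n : nat) (f : C -> C), analytic_at f p /\
    \forall w \near p^', F w = f w / (w - p) ^+ n.

Definition pole_of_order (F : C -> C) (p : C) (n : nat) : Prop :=
  (0 < n)%N /\ exists f : C -> C, [/\ analytic_at f p, f p != 0 &
    \forall w \near p^', F w = f w / (w - p) ^+ n].

(* [F], known on the side [D] of the boundary (or interior) point [p], extends
   from [D] to a function on a full neighbourhood of [p] having a pole of order
   [n] at [p].  This is how functions are regarded near the points of the rims
   on the Riemann surface. *)
Definition pole_along (D : set C) (F : C -> C) (p : C) (n : nat) : Prop :=
  exists F1 : C -> C, (\forall w \near p, D w -> F1 w = F w) /\
    pole_of_order F1 p n.

Definition C_plus : set C := [set z | 0 < Im z].

Definition C_minus : set C := [set z | Im z < 0].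

Definition first_quadrant : set C := [set z | 0 < Re z /\ 0 < Im z].

End Analytic.

Section CutPlane.
Context {R : realType}.
Local Notation C := (R[i]^o).
Variable m : R.

Definition Lambda : set C := [set z | ~ (Im z = 0 /\ - m <= Re z <= m)].

(* Both rims of the cut have the interval (-m, m) as set of complex values;
   which rim is meant is recorded by the side along which one continues. *)
Definition rim : set C := [set z | Im z = 0 /\ - m < Re z < m].

(* [Lambda] is connected, so the values on C_- are those obtained by continuing
   through R \ [-m, m]. *)
Definition meromorphic_continuation (G F : C -> C) : Prop :=
  (forall w, C_plus w -> F w = G w) /\
  (forall p, Lambda p -> meromorphic_at F p).

End CutPlane.

Section HalfLine.
Context {R : realType}.
Local Notation C := (R[i]^o).
Local Notation mu := (@lebesgue_measure R).

Definition Rplus : set R := `[0, +oo[.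

Definition cintegral (D : set R) (f : R -> C) : C :=
  (\int[mu]_(x in D) Re (f x)) +i* (\int[mu]_(x in D) Im (f x)).

Definition cintegrable (D : set R) (f : R -> C) : Prop :=
  mu.-integrable D (fun x => (Re (f x))%:E) /\
  mu.-integrable D (fun x => (Im (f x))%:E).

Definition L2 (f : R -> C) : Prop :=
  [/\ measurable_fun Rplus (fun x => Re (f x)),
      measurable_fun Rplus (fun x => Im (f x)) &
      mu.-integrable Rplus (fun x => (Re (f x) ^+ 2 + Im (f x) ^+ 2)%:E)].

(* [f] is locally absolutely continuous on R_+ and f' = g almost everywhere,
   absolutely continuous functions being the indefinite Lebesgue integrals. *)
Definition ac_derivative (f g : R -> C) : Prop :=
  (forall b, 0 <= b -> cintegrable `[0, b] g) /\
  (forall x, 0 <= x -> f x = f 0 + cintegral `[0, x] g).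

(* Pairs of functions; only the values on R_+ matter. *)
Definition spinor : Type := ((R -> C) * (R -> C))%type.

Definition L2_spinor (f : spinor) : Prop := L2 f.1 /\ L2 f.2.

(* The L^2 inner product, linear in its first argument. *)
Definition inner (f g : spinor) : C :=
  cintegral Rplus (fun x => f.1 x * (g.1 x)^* + f.2 x * (g.2 x)^* ).

Definition C0_spinor (h : spinor) : Prop :=
  [/\ {within Rplus, continuous h.1}, {within Rplus, continuous h.2} &
      exists M : R, forall x, M < x -> h.1 x = 0 /\ h.2 x = 0].

Definition nonzero_spinor (h : spinor) : Prop :=
  exists2 x, 0 <= x & h.1 x != 0 \/ h.2 x != 0.

(* An unbounded operator is given by its graph: [H f u] means that [f] is in the
   domain and [H f = u] (almost everywhere). *)
Definition operator : Type := spinor -> spinor -> Prop.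

(* The free Dirac operator with Dirichlet condition on its maximal domain:
   f absolutely continuous, f and H_0 f in L^2, f_1(0) = 0. *)
Definition free_dirac (m : R) : operator := fun f u =>
  [/\ L2_spinor f, L2_spinor u, f.1 0 = 0 &
   exists g : spinor,
     [/\ ac_derivative f.1 g.1, ac_derivative f.2 g.2 &
      {ae mu, forall x, Rplus x ->
         u.1 x = m%:C * f.1 x - g.2 x /\ u.2 x = g.1 x - m%:C * f.2 x}]].

(* (H - lambda)^-1 h, i.e. the f with H f = lambda f + h. *)
Definition resolvent (H : operator) (lambda : C) (h : spinor) : spinor :=
  xget (cst 0, cst 0) [set f : spinor |
    H f (fun x => lambda * f.1 x + h.1 x, fun x => lambda * f.2 x + h.2 x)].

Definition resolvent_form (H : operator) (h : spinor) (lambda : C) : C :=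
  inner (resolvent H lambda h) h.

End HalfLine.

Section States.
Context {R : realType}.
Local Notation C := (R[i]^o).
Variables (m : R) (H : @operator R).

Variant state_kind := Eigenvalue | Resonance | VirtualState.

(* [lambda0] is a state of the given kind because of [h], with a pole of order
   [n].  An eigenvalue lies on the rim g_+, a resonance in C_- or on the rim
   g_-.  At the branch points, z in the first quadrant parametrizes C_+ near
   [lambda0] by lambda0 + z^2, so that the continuation in z goes through C_+. *)
Definition state_pole (k : state_kind) (lambda0 : C) (h : spinor) (n : nat) :
    Prop :=
  match k with
  | Eigenvalue =>
      rim m lambda0 /\ pole_along C_plus (resolvent_form H h) lambda0 n
  | Resonance =>
      (C_minus lambda0 \/ rim m lambda0) /\
      exists F : C -> C, meromorphic_continuation m (resolvent_form H h) F /\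
        pole_along C_minus F lambda0 n
  | VirtualState =>
      (lambda0 = m%:C \/ lambda0 = - m%:C) /\
      pole_along first_quadrant
        (fun z => resolvent_form H h (lambda0 + z ^+ 2)) 0 n
  end.

Definition state_pole_order (k : state_kind) (lambda0 : C) (n : nat) : Prop :=
  exists h : spinor,
    [/\ C0_spinor h, nonzero_spinor h & state_pole k lambda0 h n].

Definition is_state (k : state_kind) (lambda0 : C) : Prop :=
  exists n, state_pole_order k lambda0 n.

Definition has_multiplicity (k : state_kind) (lambda0 : C) (n : nat) : Prop :=
  state_pole_order k lambda0 n /\
  forall n', state_pole_order k lambda0 n' -> (n' <= n)%N.

Definition simple_state (k : state_kind) (lambda0 : C) : Prop :=
  has_multiplicity k lambda0 1.

End States.

(* Main.v *)
(* For [Im l > 0] put rho = sqrt(m^2 - l^2) with Re rho > 0.  Variation of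
   parameters with the solutions phi (Dirichlet at 0), chi of (H_0 - l) f = 0
   that are entire in [l], and the decaying solution
   chi - rho / (l + m) phi = O(e^(- rho x)), gives
     ((H_0 - l)^-1 h, h) = E(l) - rho / (l + m) P(l)
   with E, P entire.  This stays bounded near every point of the closed upper
   half-plane except - m, so there is no eigenvalue and no virtual state at m.
   Any continuation F satisfies ((l + m) (F - E))^2 = (m^2 - l^2) P^2, an
   identity without square roots which persists on the whole cut plane and
   bounds F there, so there is no resonance.  At l = - m + z^2 one has
   rho / (l + m) = sqrt(2 m - z^2) / z, hence a pole of order at most one, with
   residue proportional to P(- m) = |int h_2|^2.

   Analyticity is obtained from locally uniform approximation by polynomials,
   a property that is stable under sums, products and integration against
   parameters. *)
Require Import Defs.
From mathcomp Require Import all_boot all_order all_algebra.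
From mathcomp Require Import all_classical all_reals all_analysis.
From mathcomp Require Import measurable_realfun complex cyclic separable cyclotomic zify ring lra.
Set Implicit Arguments.
Unset Strict Implicit.
Unset Printing Implicit Defensive.
Import Order.TTheory GRing.Theory Num.Theory.
Import numFieldNormedType.Exports.
Local Open Scope classical_set_scope.
Local Open Scope complex_scope.
Local Open Scope ring_scope.
Local Notation Re := complex.Re.
Local Notation Im := complex.Im.
Local Notation N := Normc.normc.

(** [free_dirac] speaks of almost everywhere derivatives and square integrability, and [resolvent]
    is a mere choice [xget] of a solution, so nothing is known about its values before existence and
    uniqueness are both proved. Uniqueness needs a regularity step, which turns the almost
    everywhere equation into a classical one, before an energy argument applies. The square root is
    the obstacle to continuation: the principal root [rho] jumps exactly across the part of the real
    axis outside [-m, m], where continuation takes place. It is approximated only in the form sqrt(2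
    m - z^2) near z = 0; elsewhere only its modulus, known from rho^2 = m^2 - l^2, is used. Poles
    are excluded by a bound at points arbitrarily near the pole, not on a neighbourhood. This fits
    [pole_along], which ties the extended function to the given one on one side only, and
    [meromorphic_continuation], whose [F] may take arbitrary values at isolated points. Analyticity
    being defined by power series, Cauchy estimates come from averages over roots of unity instead
    of contour integrals. *)

(** * The complex modulus as a real number, and the topology it induces *)

Section ComplexNorm.
Variable R : realType.
Implicit Types z w p : R[i].
Local Notation C := (R[i]^o).

Lemma norm_normc z : `|z| = (N z)%:C.
Proof. by case: z. Qed.

Lemma normc_ge0 z : 0 <= N z.
Proof. by case: z => a b; exact: sqrtr_ge0. Qed.

Lemma normcD z w : N (z + w) <= N z + N w.
Proof. exact: le_normcD. Qed.

Lemma normcN z : N (- z) = N z.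
Proof. exact: complex.normcN. Qed.

Lemma normcB z w : N (z - w) <= N z + N w.
Proof. by rewrite -(normcN w) normcD. Qed.

Lemma normc_distC z w : N (z - w) = N (w - z).
Proof. by rewrite -normcN opprB. Qed.

Lemma normc_eq0 z : (N z == 0) = (z == 0).
Proof.
by apply/eqP/eqP => [/Normc.eq0_normc//|->]; exact: Normc.normc0.
Qed.

Lemma normc_gt0 z : (0 < N z) = (z != 0).
Proof. by rewrite lt_neqAle normc_ge0 andbT eq_sym normc_eq0. Qed.

Lemma normcX z n : N (z ^+ n) = N z ^+ n.
Proof.
by elim: n => [|n ih]; rewrite ?expr0 ?exprS ?Normc.normcM ?ih //; exact: Normc.normc1.
Qed.

Lemma normcR (x : R) : N x%:C = `|x|.
Proof. by rewrite /N /real_complex_def expr0n addr0 sqrtr_sqr. Qed.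

Lemma normc_sqr z : N z ^+ 2 = Re z ^+ 2 + Im z ^+ 2.
Proof. by case: z => a b; rewrite /= sqr_sqrtr// addr_ge0 ?sqr_ge0. Qed.

Lemma Re_le_normc z : `|Re z| <= N z.
Proof.
rewrite -(@ler_pXn2r _ 2)// ?nnegrE ?normc_ge0// real_normK ?num_real//.
by rewrite normc_sqr lerDl sqr_ge0.
Qed.

Lemma Im_le_normc z : `|Im z| <= N z.
Proof.
rewrite -(@ler_pXn2r _ 2)// ?nnegrE ?normc_ge0// real_normK ?num_real//.
by rewrite normc_sqr lerDr sqr_ge0.
Qed.

Lemma normc_le_ReIm z : N z <= `|Re z| + `|Im z|.
Proof.
rewrite -(@ler_pXn2r _ 2)// ?nnegrE ?normc_ge0 ?addr_ge0// normc_sqr.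
by rewrite sqrrD !real_normK ?num_real// lerD2r lerDl mulrn_wge0 ?mulr_ge0.
Qed.

Lemma normc_subl z w : N z - N w <= N (z - w).
Proof. by rewrite lerBlDr -{1}(subrK w z) normcD. Qed.

Lemma normc_sum (I : Type) (r : seq I) (P : pred I) (F : I -> R[i]) :
  N (\sum_(i <- r | P i) F i) <= \sum_(i <- r | P i) N (F i).
Proof.
elim/big_rec2: _ => [|i y x _ h]; first by rewrite Normc.normc0.
by rewrite (le_trans (normcD _ _))// lerD2l.
Qed.

Lemma ball_normc (p : C) (r : R) (w : C) : ball p r%:C w = (N (w - p) < r)%R.
Proof. by rewrite /ball/= /ball_/= distrC norm_normc ltcR. Qed.

(** Balls of [R[i]^o] have radii in [R[i]]; a positive element there has zero imaginary part, so
    real radii suffice. *)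
Lemma near_normc (p : C) (P : C -> Prop) :
  (\forall w \near p, P w) <-> exists2 r : R, 0 < r & forall w : C, N (w - p) < r -> P w.
Proof.
split => [/nbhs_ballP[e /= e0 h]|[r r0 h]].
  have eE : e = (Re e)%:C.
    by move: e0; case: (e) => a b; rewrite ltcE/= => /andP[/eqP ->].
  exists (Re e); first by move: e0; rewrite eE ltcR.
  by move=> w wr; apply: h; rewrite eE ball_normc.
apply/nbhs_ballP; exists r%:C; first by rewrite /= ltcR.
by move=> w /=; rewrite ball_normc => /h.
Qed.

Lemma near'_normc (p : C) (P : C -> Prop) :
  (\forall w \near p^', P w) <->
  exists2 r : R, 0 < r & forall w : C, w != p -> N (w - p) < r -> P w.
Proof.
apply: iff_trans (near_normc p (fun w => w != p -> P w)) _.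
by split => -[r r0 h]; exists r => // w ? ?; exact: h.
Qed.

Lemma cvg_normc (u : nat -> C) (l : C) :
  (u @ \oo --> l) <->
  forall e : R, 0 < e -> exists n0, forall n, (n0 <= n)%N -> N (u n - l) < e.
Proof.
split=> [h e e0|h].
  have /h[n0 _ hn] : nbhs l [set w : C | N (w - l) < e].
    by apply/near_normc; exists e.
  by exists n0 => n /hn.
move=> A /near_normc[r r0 hA].
have [n0 hn] := h _ r0.
by exists n0 => // n /= /hn /hA.
Qed.

End ComplexNorm.

(** * Cauchy estimates for polynomials, and limits with explicit rates *)

Section Polynomials.
Variable R : realType.
Implicit Types (z w p : R[i]) (P Q : {poly R[i]}).

Lemma complex_prim_root_exists n :
  (0 < n)%N -> exists z : R[i], n.-primitive_root z.
Proof.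
move=> n0; have [r Dp] := closed_field_poly_normal ('X^n - 1 : {poly R[i]}).
rewrite (monicP _) ?monicXnsubC // scale1r in Dp.
have rn1 : all n.-unity_root r by apply/allP => z; rewrite -root_prod_XsubC -Dp.
have szr : (n < (size r).+1)%N.
  by rewrite -(size_prod_XsubC r id) -Dp size_XnsubC.
have [|z _ hz] := hasP (has_prim_root n0 rn1 _ szr); last by exists z.
by rewrite -separable_prod_XsubC -Dp separable_Xn_sub_1 // pnatr_eq0 -lt0n.
Qed.

(* Averaging [P (r z^l) z^(- j l)] over the powers of a primitive root of unity
   [z] of order [size P] isolates the coefficient of degree [j]. *)
Lemma normc_coef_le P (r B : R) j : 0 < r ->
  (forall w, N w <= r -> N P.[w] <= B) -> N P`_j * r ^+ j <= B.
Proof.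
move=> r0 hP.
have [jP|jP] := ltnP j (size P); last first.
  rewrite nth_default// Normc.normc0 mul0r (le_trans (normc_ge0 P.[0]))//.
  by apply: hP; rewrite Normc.normc0 ltW.
set n := size P in jP *.
have n0 : (0 < n)%N by rewrite (leq_ltn_trans _ jP).
have [z zP] := complex_prim_root_exists n0.
have zn1 : z ^+ n = 1 by exact: prim_expr_order.
have Nz : N z = 1.
  have /eqP : N z ^+ n = 1 by rewrite -normcX zn1 Normc.normc1.
  by rewrite pexpr_eq1 ?normc_ge0// => /eqP.
have sumE : \sum_(l < n) P.[r%:C * z ^+ l] * (z ^+ (n - j)) ^+ l =
    n%:R * (P`_j * r%:C ^+ j).
  transitivity (\sum_(i < n) P`_i * r%:C ^+ i * \sum_(l < n) (z ^+ (i + (n - j))) ^+ l).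
    under eq_bigr do rewrite horner_coef big_distrl/=.
    rewrite exchange_big/=; apply: eq_bigr => i _.
    rewrite big_distrr/=; apply: eq_bigr => l _.
    rewrite exprMn -!exprM mulnDl exprD mulnC -!mulrA.
    by congr (_ * (_ * (_ * _))); rewrite mulnC.
  rewrite (bigD1 (Ordinal jP))//= [X in _ + X]big1 ?addr0 => [|i ij].
    rewrite subnKC ?(ltnW jP)// zn1.
    under eq_bigr do rewrite expr1n.
    by rewrite sumr_const card_ord mulrC.
  have yn : (z ^+ (i + (n - j))) ^+ n = 1 by rewrite exprAC zn1 expr1n.
  (* The exponent lies strictly between 0 and 2 n, and equals n only for i = j. *)
  have y1 : z ^+ (i + (n - j)) != 1.
    rewrite -(prim_order_dvd zP); apply/negP => /dvdnP[k kE].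
    have ijn : (nat_of_ord i <> j) by move=> h; move/eqP: ij; apply; exact: val_inj.
    have := ltn_ord i; clear ij; case: k kE => [|[|k]]; rewrite ?mul0n ?mul1n ?mulSn; lia.
  have /eqP := subrX1 (z ^+ (i + (n - j))) n.
  rewrite yn subrr eq_sym mulf_eq0 subr_eq0 (negbTE y1)/= => /eqP ->.
  by rewrite mulr0.
have : N (n%:R * (P`_j * r%:C ^+ j)) <= \sum_(l < n) B.
  rewrite -sumE (le_trans (normc_sum _ _ _))//; apply: ler_sum => l _.
  rewrite Normc.normcM !normcX Nz !expr1n mulr1; apply: hP.
  by rewrite Normc.normcM normcX Nz expr1n mulr1 normcR gtr0_norm.
rewrite sumr_const card_ord !Normc.normcM normcX normcR gtr0_norm//.
have -> : N (n%:R : R[i]) = n%:R.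
  have -> : (n%:R : R[i]) = (n%:R)%:C by rewrite rmorph_nat.
  by rewrite normcR ger0_norm.
by rewrite -[B *+ _]mulr_natl ler_pM2l// ltr0n.
Qed.

Lemma normc_horner_le P (r : R) : 0 <= r ->
  exists2 B, 0 <= B & forall w, N w <= r -> N P.[w] <= B.
Proof.
move=> r0; exists (\sum_(i < size P) N P`_i * r ^+ i).
  by apply: sumr_ge0 => i _; rewrite mulr_ge0 ?normc_ge0 ?exprn_ge0.
move=> w wr; rewrite horner_coef (le_trans (normc_sum _ _ _))//.
apply: ler_sum => i _; rewrite Normc.normcM normcX ler_wpM2l ?normc_ge0//.
by rewrite lerXn2r ?nnegrE ?normc_ge0.
Qed.

(* The limit is the supremum of the lower bounds [x n - e n]. *)
Lemma real_cauchy_limit (x e : nat -> R) :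
  (forall n k, `|x n - x k| <= e n + e k) ->
  exists l, forall n, `|x n - l| <= e n.
Proof.
move=> h; pose A := [set y | exists n, y = x n - e n].
have ubA k : ubound A (x k + e k).
  move=> _ [n ->]; have := h n k; rewrite ler_norml => /andP[_]; lra.
have A0 : A !=set0 by exists (x 0 - e 0), 0.
exists (sup A) => n; rewrite ler_norml; apply/andP; split.
  suff : sup A <= x n + e n by lra.
  by apply: ge_sup.
suff : x n - e n <= sup A by lra.
by apply: sup_upper_bound; [split => //; exists (x 0 + e 0) | exists n].
Qed.

(** The factor 2 comes from taking limits of the real and imaginary parts separately. *)
Lemma complex_cauchy_limit (u : nat -> R[i]) (e : nat -> R) :
  (forall n k, N (u n - u k) <= e n + e k) ->
  exists l, forall n, N (u n - l) <= 2 * e n.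
Proof.
move=> h.
have [a ha] : exists l, forall n, `|Re (u n) - l| <= e n.
  apply: real_cauchy_limit => n k; apply: le_trans (h n k).
  by rewrite -raddfB; exact: Re_le_normc.
have [b hb] : exists l, forall n, `|Im (u n) - l| <= e n.
  apply: real_cauchy_limit => n k; apply: le_trans (h n k).
  by rewrite -raddfB; exact: Im_le_normc.
exists (a +i* b) => n; rewrite (le_trans (normc_le_ReIm _))//.
rewrite !raddfB/= mulr_natl mulr2n.
by apply: lerD; [exact: ha|exact: hb].
Qed.

End Polynomials.

(** * Taylor remainders, isolated zeros, and analyticity of uniform limits of polynomials *)

Section Analyticity.
Variable R : realType.
Local Notation C := (R[i]^o).
Implicit Types (p w u : R[i]) (f g : C -> C).

(** A Taylor remainder bound uniform in the number of terms [J]: one term gives continuity, one term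
    past the leading one gives isolated zeros, and [J] tending to infinity gives polynomial
    approximation. *)
Definition expands_at f p (a : nat -> C) (d B : R) := forall u J, N u <= d ->
  N (f (p + u) - \sum_(j < J) a j * u ^+ j) <= B * (N u / d) ^+ J.

(** The bound telescopes: 2 q <= 1 gives q^k <= 2 q^k - 2 q^(k+1), so each new term of the block is
    absorbed in turn. *)
Lemma power_series_tail (a : nat -> R[i]) (B q : R) u : 0 <= q -> 2 * q <= 1 ->
  (forall k, N (a k * u ^+ k) <= B * q ^+ k) ->
  forall J d, N (\sum_(j < J + d) a j * u ^+ j - \sum_(j < J) a j * u ^+ j) <=
    B * (2 * q ^+ J - 2 * q ^+ (J + d)).
Proof.
move=> q0 q1 h J; elim=> [|d ih].
  by rewrite addn0 !subrr Normc.normc0 mulr0.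
have B0 : 0 <= B by have := h 0%N; rewrite !expr0 !mulr1; apply: (le_trans (normc_ge0 _)).
rewrite addnS big_ord_recr/= addrAC (le_trans (normcD _ _))//.
apply: (le_trans (lerD ih (h _))).
rewrite -mulrDr ler_wpM2l// exprS.
have : 0 <= q ^+ (J + d) by exact: exprn_ge0.
nra.
Qed.

(** Convergence at the single point p + s bounds the terms there by [B0]; for |u| <= s / 2 they are
    then dominated by a geometric series of ratio at most 1/2. *)
Lemma analytic_expands f p : analytic_at f p ->
  exists a d B, [/\ 0 < d, 0 <= B & expands_at f p a d B].
Proof.
move=> [a /near_normc[r r0 ha]].
pose s := r / 2; have s0 : 0 < s by rewrite /s; lra.
have /cvg_normc /(_ _ ltr01)[n0 hn0] := ha (p + s%:C)
  ltac:(by rewrite addrC addKr normcR gtr0_norm// /s; lra).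
have termE k : N (a k * s%:C ^+ k) = N (a k) * s ^+ k.
  by rewrite Normc.normcM normcX normcR gtr0_norm.
have [B0 B00 hB0] : exists2 B0, 0 <= B0 & forall k, N (a k) * s ^+ k <= B0.
  (* From [n0] on, consecutive partial sums are within 1 of the limit, so their difference is at
     most 2; the finite sum covers the earlier terms. *)
  exists (2 + \sum_(k < n0) N (a k) * s ^+ k).
    by rewrite addr_ge0// sumr_ge0// => i _; rewrite mulr_ge0 ?normc_ge0 ?exprn_ge0 ?ltW.
  move=> k; have [kn|kn] := ltnP k n0.
    rewrite (bigD1 (Ordinal kn))//= addrCA lerDl addr_ge0// sumr_ge0// => i _.
    by rewrite mulr_ge0 ?normc_ge0 ?exprn_ge0 ?ltW.
  apply: (@le_trans _ _ 2); last first.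
    by rewrite lerDl sumr_ge0// => i _; rewrite mulr_ge0 ?normc_ge0 ?exprn_ge0 ?ltW.
  have h1 := hn0 _ kn; have h2 := hn0 k.+1 (leqW kn).
  rewrite -termE; have -> : a k * s%:C ^+ k =
      (series (fun k => a k * ((p + s%:C) - p) ^+ k) k.+1 - f (p + s%:C)) -
      (series (fun k => a k * ((p + s%:C) - p) ^+ k) k - f (p + s%:C)).
    by rewrite /series/= big_nat_recr//= [p + _]addrC addrK opprB addrA subrK addrC addKr.
  by rewrite (le_trans (normcB _ _))//; lra.
exists a, (s / 2), (2 * B0); split; [by lra|by lra|] => u J ud.
pose q := N u / s.
have q0 : 0 <= q by rewrite /q divr_ge0 ?normc_ge0 ?ltW.
have q1 : 2 * q <= 1.
  by rewrite /q mulrA ler_pdivrMr//; lra.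
have hq k : N (a k * u ^+ k) <= B0 * q ^+ k.
  rewrite Normc.normcM normcX /q expr_div_n mulrA ler_pdivlMr ?exprn_gt0//.
  by rewrite mulrAC ler_wpM2r ?exprn_ge0 ?normc_ge0.
apply: (@le_trans _ _ (2 * B0 * q ^+ J)); last first.
  rewrite ler_wpM2l//; first lra.
  rewrite lerXn2r ?nnegrE//; first by rewrite divr_ge0 ?normc_ge0//; lra.
  rewrite /q ler_wpM2l ?normc_ge0// lef_pV2 ?posrE//; lra.
apply/ler_addgt0Pr => e e0.
have /cvg_normc /(_ _ e0)[n1 hn1] := ha (p + u) ltac:(by rewrite addrC addKr; rewrite /s in ud; lra).
have h1 : N (\sum_(j < J + n1) a j * u ^+ j - f (p + u)) < e.
  move: (hn1 (J + n1)%N (leq_addl _ _)); rewrite /series/= big_mkord/=.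
  by under eq_bigr do rewrite addrAC subrr add0r.
have h2 := power_series_tail q0 q1 hq J n1.
have -> : f (p + u) - \sum_(j < J) a j * u ^+ j =
   (\sum_(j < J + n1) a j * u ^+ j - \sum_(j < J) a j * u ^+ j) -
   (\sum_(j < J + n1) a j * u ^+ j - f (p + u)) by ring.
rewrite (le_trans (normcB _ _))// lerD//; last exact: ltW.
apply: (le_trans h2); rewrite mulrBr.
have : 0 <= B0 * (2 * q ^+ (J + n1)) by rewrite mulr_ge0// mulr_ge0// exprn_ge0.
nra.
Qed.

Lemma expands_at0 f p a d B : 0 < d -> expands_at f p a d B -> a 0%N = f p.
Proof.
move=> d0 h; have := h 0 1%N; rewrite Normc.normc0 mul0r expr1 mulr0 big_ord1 expr0 mulr1 addr0.
move=> /(_ (ltW d0)) hn; apply/eqP; rewrite eq_sym -subr_eq0 -normc_eq0.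
by rewrite eq_le hn normc_ge0.
Qed.

Lemma analytic_continuous f p : analytic_at f p ->
  forall e : R, 0 < e ->
    exists2 d : R, 0 < d & forall w, N (w - p) < d -> N (f w - f p) < e.
Proof.
move=> /analytic_expands[a [d [B [d0 B0 h]]]] e e0.
exists (Num.min d (e * d / (B + 1))).
  by rewrite lt_min d0 divr_gt0 ?mulr_gt0//; lra.
move=> w; rewrite lt_min => /andP[wd we].
have := h (w - p) 1%N (ltW wd).
have wE : p + (w - p) = w by rewrite addrC subrK.
rewrite big_ord1 expr0 mulr1 (expands_at0 d0 h) wE expr1.
move=> /le_lt_trans; apply.
move: we; rewrite ltr_pdivlMr; last lra.
rewrite mulrA ltr_pdivrMr//.
have := normc_ge0 (w - p); nra.
Qed.

(** If all coefficients vanish, the remainder bound forces f = 0 on half the radius. Otherwise the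
    first nonzero term dominates the remainder near p. *)
Lemma analytic_dichotomy f p : analytic_at f p ->
  (exists2 d : R, 0 < d & forall w, N (w - p) < d -> f w = 0) \/
  (exists2 d : R, 0 < d & forall w, w != p -> N (w - p) < d -> f w != 0).
Proof.
move=> /analytic_expands[a [d [B [d0 B0 h]]]].
have [a0|/existsNP/cid[j0 aj0]] := pselect (forall j, a j = 0).
  left; exists (d / 2); first lra.
  move=> w wd; apply/eqP; rewrite -normc_eq0 eq_le normc_ge0 andbT.
  pose q := N (w - p) / d.
  have q0 : 0 <= q by rewrite divr_ge0 ?normc_ge0// ltW.
  have q1 : q <= 2^-1 by rewrite ler_pdivrMr//; lra.
  have fw J : N (f w) <= B * 2^-1 ^+ J.
    have := h (w - p) J ltac:(by lra); rewrite big1 => [|j _]; last by rewrite a0 mul0r.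
    have wE : p + (w - p) = w by rewrite addrC subrK.
    rewrite wE subr0 => /le_trans; apply; rewrite ler_wpM2l//.
    by rewrite lerXn2r ?nnegrE//; lra.
  apply/ler_addgt0Pr => e e0; rewrite add0r.
  have [n hn] : exists n, B < e * n.+1%:R.
    by exists (Num.trunc (B / e)); rewrite mulrC -ltr_pdivrMr// truncnS_gt.
  apply: (le_trans (fw n)).
  rewrite exprVn ler_pdivrMr ?exprn_gt0// ltW// (lt_le_trans hn)//.
  rewrite ler_wpM2l ?(ltW e0)// -natrX ler_nat.
  exact: ltn_expl.
right.
have exj : exists j, a j != 0 by exists j0; apply/eqP.
pose j := ex_minn exj; have [aj hj] : a j != 0 /\ forall i, (i < j)%N -> a i = 0.
  rewrite /j; case: ex_minnP => k ak hk; split=> // i ik; apply/eqP/negPn/negP.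
  by move=> /hk; rewrite leqNgt ik.
have aj0' : 0 < N (a j) by rewrite normc_gt0.
(* The remainder after the leading term is at most D |u|^(j+1), smaller than |a_j u^j| once |u| <
   |a_j| / (D + 1) and u is not 0. *)
pose D := B / d ^+ j.+1.
have D0 : 0 <= D by apply: divr_ge0 => //; apply: exprn_ge0; exact: ltW.
exists (Num.min d (N (a j) / (D + 1))).
  by rewrite lt_min d0 divr_gt0//; lra.
move=> w wp; rewrite lt_min => /andP[wd we].
have wp0 : 0 < N (w - p) by rewrite normc_gt0 subr_eq0.
apply/eqP => fw0.
have := h (w - p) j.+1 (ltW wd).
have wE : p + (w - p) = w by rewrite addrC subrK.
rewrite wE fw0 big_ord_recr/= big1 => [|i _]; last by rewrite hj// mul0r.
rewrite sub0r add0r normcN Normc.normcM normcX expr_div_n mulrCA -/D mulrC exprSr -mulrA.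
rewrite ler_pM2l ?exprn_gt0//.
move: we; rewrite ltr_pdivlMr; last lra.
nra.
Qed.

Definition polapprox f p (r : R) := forall e : R, 0 < e ->
  exists P : {poly R[i]}, forall w, N (w - p) <= r -> N (f w - P.[w]) <= e.

(* Weierstrass: by the Cauchy estimates, the Taylor coefficients at [p] of
   polynomials that converge uniformly converge, to the coefficients of a power
   series of the limit on the disc of half the radius. *)
Lemma polapprox_analytic f p r : 0 < r -> polapprox f p r -> analytic_at f p.
Proof.
move=> r0 h.
pose e (n : nat) : R := n.+1%:R^-1.
have e0 n : 0 < e n by rewrite invr_gt0 ltr0n.
have /choice[P hP] n := h _ (e0 n).
pose Q n := P n \Po ('X + p%:P).
have QE n u : (Q n).[u] = (P n).[p + u] by rewrite horner_comp !hornerE addrC.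
have hQ n u : N u <= r -> N (f (p + u) - (Q n).[u]) <= e n.
  by move=> ur; rewrite QE hP// addrC addKr.
have hc j n k : N ((Q n)`_j - (Q k)`_j) <= e n / r ^+ j + e k / r ^+ j.
  rewrite -mulrDl ler_pdivlMr ?exprn_gt0// -coefB.
  apply: normc_coef_le => // w wr; rewrite hornerD hornerN.
  have -> : (Q n).[w] - (Q k).[w] = (f (p + w) - (Q k).[w]) - (f (p + w) - (Q n).[w]).
    by rewrite opprB [RHS]addrC addrA subrK.
  by rewrite (le_trans (normcB _ _))// addrC lerD ?hQ.
have /choice[b hb] j := complex_cauchy_limit (hc j).
exists b; apply/near_normc; exists (r / 2); first lra.
move=> w wr; apply/cvg_normc => eps eps0.
have [n hn] : exists n, 6 * e n < eps.
  exists (Num.trunc (6 / eps)); rewrite /e ltr_pdivrMr// mulrC -ltr_pdivrMr//.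
  exact: truncnS_gt.
(* From here on the partial sum sees all of [Q n]; the [b j] of higher degree are small too, being
   compared with zero coefficients. *)
exists (size (Q n)) => J hJ.
rewrite /series/= big_mkord; set u := w - p.
have -> : w = p + u by rewrite addrC subrK.
(* [b j] differs from the coefficient by at most 2 e_n / r^j, and |u| <= r / 2 turns the total into
   2 e_n times a geometric sum of ratio 1/2. *)
have hsum : N (\sum_(j < J) b j * u ^+ j - (Q n).[u]) <= 4 * e n.
  rewrite (horner_coef_wide _ hJ) -sumrB (le_trans (normc_sum _ _ _))//.
  apply: (@le_trans _ _ (\sum_(j < J) 2 * e n * 2^-1 ^+ j)).
    apply: ler_sum => j _; rewrite -mulrBl Normc.normcM normcX normc_distC.
    have := hb j n; rewrite mulrA ler_pdivlMr ?exprn_gt0// => hbj.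
    apply: le_trans (ler_wpM2r _ hbj); last by rewrite exprn_ge0// invr_ge0.
    rewrite -mulrA -exprMn ler_wpM2l ?normc_ge0//.
    by rewrite lerXn2r ?nnegrE ?normc_ge0//; lra.
  rewrite -mulr_sumr.
  have -> : \sum_(i < J) 2^-1 ^+ i = 2 - 2 * 2^-1 ^+ J :> R.
    elim: (J) => [|k ih]; first by rewrite big_ord0 expr0 mulr1 subrr.
    by rewrite big_ord_recr/= ih exprS mulrA mulfV// mul1r; lra.
  have : 0 <= 2^-1 ^+ J :> R by rewrite exprn_ge0.
  have := e0 n; nra.
have h2 : N (f (p + u) - (Q n).[u]) <= e n.
  by apply: hQ; rewrite /u; lra.
have -> : \sum_(j < J) b j * u ^+ j - f (p + u) =
  (\sum_(j < J) b j * u ^+ j - (Q n).[u]) - (f (p + u) - (Q n).[u]) by ring.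
rewrite (le_lt_trans (normcB _ _))//.
have := e0 n; lra.
Qed.

End Analyticity.

(** * Algebra of uniform polynomial approximation, and a criterion bounding the order of a pole *)

Section PolynomialApproximation.
Variable R : realType.
Local Notation C := (R[i]^o).
Implicit Types (p w u : R[i]) (f g : C -> C) (r : R).

Lemma polapprox_bounded f p r : polapprox f p r ->
  exists2 B : R, 0 <= B & forall w, N (w - p) <= r -> N (f w) <= B.
Proof.
move=> /(_ _ ltr01)[P hP].
have [r0|r0] := leP 0 r; last first.
  by exists 0 => // w /le_lt_trans /(_ r0); rewrite ltNge normc_ge0.
have [B B0 hB] := normc_horner_le P (addr_ge0 r0 (normc_ge0 p)).
exists (B + 1); first lra.
move=> w wr; have := hP _ wr; have := normc_subl (f w) P.[w].
have : N P.[w] <= B.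
  apply: hB; rewrite -{1}(subrK p w) (le_trans (normcD _ _))//.
  by rewrite lerD2r.
lra.
Qed.

Lemma polapprox_ext f g p r : (forall w, N (w - p) <= r -> f w = g w) ->
  polapprox f p r -> polapprox g p r.
Proof.
by move=> fg h e /h[P hP]; exists P => w wr; rewrite -fg// hP.
Qed.

Lemma polapprox_horner (P : {poly R[i]}) p r : polapprox (horner P) p r.
Proof. by move=> e e0; exists P => w _; rewrite subrr Normc.normc0 ltW. Qed.

Lemma polapproxD f g p r : polapprox f p r -> polapprox g p r ->
  polapprox (fun w => f w + g w) p r.
Proof.
move=> hf hg e e0.
have e2 : 0 < e / 2 by lra.
have [P hP] := hf _ e2; have [Q hQ] := hg _ e2.
exists (P + Q) => w wr; rewrite hornerD opprD addrACA (le_trans (normcD _ _))//.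
by have := hP _ wr; have := hQ _ wr; lra.
Qed.

Lemma polapproxM f g p r : polapprox f p r -> polapprox g p r ->
  polapprox (fun w => f w * g w) p r.
Proof.
move=> hf hg e e0.
have [A A0 hA] := polapprox_bounded hf; have [B B0 hB] := polapprox_bounded hg.
pose e1 := Num.min 1 (e / (A + B + 1)).
have e10 : 0 < e1 by rewrite lt_min ltr01 divr_gt0//; lra.
have e11 : e1 <= 1 by rewrite ge_min lexx.
have e1e : e1 * (A + B + 1) <= e.
  by rewrite -ler_pdivlMr; [rewrite ge_min lexx orbT|lra].
have [P hP] := hf _ e10; have [Q hQ] := hg _ e10.
exists (P * Q) => w wr; rewrite hornerM.
have -> : f w * g w - P.[w] * Q.[w] = f w * (g w - Q.[w]) + (f w - P.[w]) * Q.[w].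
  by ring.
rewrite (le_trans (normcD _ _))// !Normc.normcM.
have hQw : N Q.[w] <= B + 1.
  have := normc_subl Q.[w] (g w); rewrite normc_distC.
  by have := hQ _ wr; have := hB _ wr; lra.
have := hP _ wr; have := hQ _ wr; have := hA _ wr.
have := normc_ge0 (f w); have := normc_ge0 (f w - P.[w]).
have := normc_ge0 (g w - Q.[w]); have := normc_ge0 Q.[w].
move=> h1 h2 h3 h4 h5 h6 h7.
have k1 : N (f w) * N (g w - Q.[w]) <= A * e1 by exact: ler_pM.
have k2 : N (f w - P.[w]) * N Q.[w] <= e1 * (B + 1) by exact: ler_pM.
lra.
Qed.

Lemma polapprox_cst (c : R[i]) p r : polapprox (fun=> c) p r.
Proof.
by apply: polapprox_ext (polapprox_horner c%:P p r) => w _; rewrite hornerC.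
Qed.

Lemma polapproxX f p r n : polapprox f p r -> polapprox (fun w => f w ^+ n) p r.
Proof.
move=> h; elim: n => [|n ih].
  by apply: polapprox_ext (polapprox_cst 1 p r) => w _; rewrite expr0.
by apply: polapprox_ext (polapproxM h ih) => w _; rewrite exprS.
Qed.

Lemma polapproxB f g p r : polapprox f p r -> polapprox g p r ->
  polapprox (fun w => f w - g w) p r.
Proof.
move=> hf hg; apply: polapprox_ext (polapproxD hf (polapproxM (polapprox_cst (-1) p r) hg)).
by move=> w _; rewrite mulN1r.
Qed.

Lemma polapprox_comp f p r (Q : {poly R[i]}) q s : polapprox f p r ->
  (forall w, N (w - q) <= s -> N (Q.[w] - p) <= r) ->
  polapprox (fun w => f Q.[w]) q s.
Proof.
move=> hf hQ e /hf[P hP]; exists (P \Po Q) => w ws.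
by rewrite horner_comp hP// hQ.
Qed.

(** The converse of [polapprox_analytic]: on half the radius, the remainder after n terms is at most
    B / 2^n. *)
Lemma analytic_polapprox f p : analytic_at f p -> exists2 r, 0 < r & polapprox f p r.
Proof.
move=> /analytic_expands[a [d [B [d0 B0 h]]]].
exists (d / 2); first lra.
move=> e e0.
have [n hn] : exists n, B < e * n.+1%:R.
  by exists (Num.trunc (B / e)); rewrite mulrC -ltr_pdivrMr// truncnS_gt.
exists ((\poly_(j < n) a j) \Po ('X - p%:P)) => w wd.
have wE : p + (w - p) = w by rewrite addrC subrK.
have := h (w - p) n ltac:(by lra).
rewrite wE horner_comp horner_poly !hornerE => /le_trans; apply.
apply: (@le_trans _ _ (B * 2^-1 ^+ n)).
  have q0 : 0 <= N (w - p) / d by rewrite divr_ge0 ?normc_ge0// ltW.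
  have q1 : N (w - p) / d <= 2^-1 by rewrite ler_pdivrMr//; lra.
  by rewrite ler_wpM2l// lerXn2r ?nnegrE//; lra.
rewrite exprVn ler_pdivrMr ?exprn_gt0// ltW// (lt_le_trans hn)//.
by rewrite ler_wpM2l ?(ltW e0)// -natrX ler_nat; exact: ltn_expl.
Qed.

(** If e < n, then f(w) = F(w) (w - p)^n would be O(|w - p|) at points tending to p, although f is
    continuous and nonzero at p. Control on one side of p is therefore enough. *)
Lemma pole_order_le (F : C -> C) p (D : set C) (n e : nat) (B : R) :
  pole_of_order F p n ->
  (forall d : R, 0 < d -> exists w, [/\ w != p, N (w - p) < d, D w &
     N (F w) * N (w - p) ^+ e <= B]) ->
  (n <= e)%N.
Proof.
move=> [n0 [f [fa fp /near'_normc[r r0 hF]]]] h.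
rewrite leqNgt; apply/negP => en.
have fp0 : 0 < N (f p) by rewrite normc_gt0.
have [d d0 hd] := analytic_continuous fa (e := N (f p) / 2) ltac:(by lra).
have B0 : 0 <= `|B| by [].
(* The last entry makes |B| |w - p| smaller than |f(p)| / 2, against |f(w) - f(p)| < |f(p)| / 2. *)
pose d' := Num.min (Num.min r d) (Num.min 1 (N (f p) / 2 / (`|B| + 1))).
have d'0 : 0 < d' by rewrite !lt_min r0 d0 ltr01/= divr_gt0//; lra.
have [w [wp wd _ hB]] := h _ d'0.
move: wd; rewrite !lt_min => /andP[/andP[wr wd] /andP[w1 wB]].
have x0 : 0 < N (w - p) by rewrite normc_gt0 subr_eq0.
have fw : N (f w) = N (F w) * N (w - p) ^+ n.
  by rewrite hF// -normcX -Normc.normcM divfK// expf_neq0// subr_eq0.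
have {}hd := hd _ wd.
have : N (f w) <= `|B| * N (w - p).
  rewrite fw; have -> : n = (e + (n - e.+1).+1)%N by rewrite addnS -addSn subnKC.
  rewrite exprD mulrA exprS.
  have h1 : N (w - p) ^+ (n - e.+1) <= 1 by rewrite exprn_ile1// ltW.
  have h2 : 0 <= N (w - p) ^+ (n - e.+1) by rewrite exprn_ge0// ltW.
  have h3 : 0 <= N (F w) * N (w - p) ^+ e.
    by rewrite mulr_ge0 ?exprn_ge0 ?normc_ge0.
  have h4 : N (F w) * N (w - p) ^+ e <= `|B| by rewrite (le_trans hB)// ler_norm.
  apply: ler_pM => //; first by rewrite mulr_ge0// ltW.
  by rewrite -[leRHS]mulr1 ler_wpM2l// ltW.
have := normc_subl (f p) (f w); rewrite normc_distC.
move: wB; rewrite ltr_pdivlMr; last lra.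
nra.
Qed.

End PolynomialApproximation.

(** * Primitives of continuous functions on the half-line *)

Section RealPrimitive.
Variable R : realType.
Local Notation mu := (@lebesgue_measure R).
Implicit Types (f g F : R -> R) (x y a b : R).

(** For negative [x] the interval is empty and the value is 0: the function stays continuous on the
    whole line but is in general not differentiable at 0. *)
Definition rprim f x : R := \int[mu]_(t in `[0, x]) f t.

Lemma continuous_integrable_itv f a b : continuous f ->
  mu.-integrable `[a, b] (EFin \o f).
Proof.
move=> cf; apply: continuous_compact_integrable; first exact: segment_compact.
exact: continuous_subspaceT.
Qed.

Lemma is_derive_continuous f x d : is_derive x 1 f d -> {for x, continuous f}.
Proof. by move=> h; apply: differentiable_continuous; apply/derivable1_diffP; exact: ex_derive. Qed.

Lemma rprim0 f : rprim f 0 = 0.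
Proof. by rewrite /rprim set_itv1 Rintegral_set1. Qed.

(* Integrating from [-1] gives a function that is differentiable near [0] too. *)
Let F1 f x : R := \int[mu]_(t in `[-1, x]) f t.

Let F1_derive f x : continuous f -> -1 < x -> is_derive x 1 (F1 f) (f x).
Proof.
move=> cf x1.
have [] := @continuous_FTC1_closed _ f (-1) x (x + 1) _ _ x1 (cf x).
- by rewrite ltrDl.
- exact: continuous_integrable_itv.
- by move=> d1 d2; apply: DeriveDef; [exact: d1|rewrite -derive1E].
Qed.

Let rprimE f x : continuous f -> 0 <= x -> rprim f x = F1 f x - F1 f 0.
Proof.
move=> cf x0; rewrite /F1 Rintegral_itvB.
- rewrite Rintegral_itv_obnd_cbnd//.
  by apply: integrableS (continuous_integrable_itv 0 x cf) => //; apply: subset_itvr; rewrite bnd_simp.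
- exact: continuous_integrable_itv.
- by rewrite bnd_simp; lra.
- by rewrite bnd_simp.
Qed.

Lemma rprim_derive f x : continuous f -> 0 < x -> is_derive x 1 (rprim f) (f x).
Proof.
move=> cf x0.
apply: (@near_eq_is_derive _ _ _ (fun y => F1 f y - F1 f 0)).
  near=> y; rewrite rprimE//.
  by apply: ltW; near: y; exact: lt_nbhsr.
have -> : f x = f x - 0 by rewrite subr0.
apply: is_deriveB; apply: F1_derive => //; lra.
Unshelve. all: by end_near. Qed.

Lemma rprim_continuous f : continuous f -> continuous (rprim f).
Proof.
move=> cf.
have -> : rprim f = (fun y => F1 f y - F1 f 0) \o (fun x => Num.max x 0).
  apply/funext => x /=; have [x0|x0] := leP 0 x.
    by rewrite rprimE.
  by rewrite subrr /rprim set_itv_ge ?Rintegral_set0// bnd_simp -ltNge.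
move=> x; apply: continuous_comp.
  by apply: (@continuous_max _ _ (id : R -> R^o) (cst 0)) => //; exact: cvg_cst.
apply: cvgB; last exact: cvg_cst.
apply: is_derive_continuous (F1_derive cf _).
have : 0 <= Num.max x 0 by rewrite le_max lexx orbT.
lra.
Qed.

(** Derivatives are asked for on the open half-line only, which is where primitives have them;
    continuity handles the endpoint 0. *)
Lemma rprim_FTC2 F f x : continuous F -> continuous f ->
  (forall y, 0 < y -> is_derive y 1 F (f y)) -> 0 <= x -> F x = F 0 + rprim f x.
Proof.
move=> cF cf dF; rewrite le_eqVlt => /predU1P[<-|x0]; first by rewrite rprim0 addr0.
rewrite /rprim /Rintegral (@continuous_FTC2 _ _ F)//=.
- by rewrite addrCA subrr addr0.
- exact: continuous_subspaceT.
- split.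
  + move=> y; rewrite in_itv/= => /andP[y0 _].
    by have := dF _ y0 => h; exact: ex_derive.
  + by apply: cvg_at_right_filter; exact: cF.
  + by apply: cvg_at_left_filter; exact: cF.
- move=> y; rewrite in_itv/= => /andP[y0 _].
  by have := dF _ y0 => h; rewrite derive1E derive_val.
Qed.

Lemma rprim_eq f g x : (forall y, 0 <= y <= x -> f y = g y) -> rprim f x = rprim g x.
Proof.
by move=> h; apply: eq_Rintegral => y; rewrite inE/= in_itv/= => /h.
Qed.

Lemma rprimD f g x : continuous f -> continuous g ->
  rprim (fun y => f y + g y) x = rprim f x + rprim g x.
Proof. by move=> cf cg; rewrite /rprim RintegralD//; exact: continuous_integrable_itv. Qed.

Lemma rprimZ f c x : continuous f -> rprim (fun y => c * f y) x = c * rprim f x.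
Proof. by move=> cf; rewrite /rprim RintegralZl//; exact: continuous_integrable_itv. Qed.

Lemma rprim_le f g x : continuous f -> continuous g ->
  (forall y, 0 <= y <= x -> f y <= g y) -> rprim f x <= rprim g x.
Proof.
move=> cf cg h; apply: le_Rintegral => //; exact: continuous_integrable_itv.
Qed.

Lemma rprim_ndecr f x y : continuous f -> (forall z, 0 <= z -> 0 <= f z) ->
  0 <= x <= y -> rprim f x <= rprim f y.
Proof.
move=> cf f0 /andP[x0 xy].
apply: (@ger0_derive1_le_cc _ (rprim f) 0 y) => //.
- move=> z; rewrite in_itv/= => /andP[z0 _].
  by have := rprim_derive cf z0 => h; exact: ex_derive.
- move=> z; rewrite in_itv/= => /andP[z0 _].
  by have := rprim_derive cf z0 => h; rewrite derive1E derive_val f0// ltW.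
- apply: continuous_subspaceT; exact: rprim_continuous.
- by rewrite in_itv/= x0.
- by rewrite in_itv/= lexx (le_trans x0).
Qed.

Lemma is_deriveE f x d d' : is_derive x 1 f d -> d = d' -> is_derive x 1 f d'.
Proof. by move=> h <-. Qed.

End RealPrimitive.

(** * Componentwise calculus for complex functions of a real variable, and the exponential *)

Section ComplexCalculus.
Variable R : realType.
Implicit Types (f g F : R -> R[i]) (x y : R) (z w c d : R[i]).

Lemma ReM z w : Re (z * w) = Re z * Re w - Im z * Im w.
Proof. by case: z; case: w. Qed.

Lemma ImM z w : Im (z * w) = Re z * Im w + Im z * Re w.
Proof. by case: z; case: w. Qed.

Lemma ReD z w : Re (z + w) = Re z + Re w.
Proof. by case: z; case: w. Qed.

Lemma ImD z w : Im (z + w) = Im z + Im w.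
Proof. by case: z; case: w. Qed.

Definition ccont f := continuous (fun x => Re (f x)) /\ continuous (fun x => Im (f x)).

Lemma ccont_ext f g : (forall x, f x = g x) -> ccont f -> ccont g.
Proof. by move=> fg; rewrite (_ : f = g)//; exact/funext. Qed.

Lemma ccont_cst c : ccont (fun=> c).
Proof. by split => x; exact: cvg_cst. Qed.

Lemma ccont_real (f : R -> R) : continuous f -> ccont (fun x => (f x)%:C).
Proof. by move=> cf; split => // x; exact: cvg_cst. Qed.

Lemma ccontD f g : ccont f -> ccont g -> ccont (fun x => f x + g x).
Proof.
move=> [f1 f2] [g1 g2]; split => x.
  have -> : (fun x => Re (f x + g x)) = (fun x => Re (f x) + Re (g x)).
    by apply/funext => t; rewrite raddfD.
  by apply: cvgD; [exact: f1|exact: g1].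
have -> : (fun x => Im (f x + g x)) = (fun x => Im (f x) + Im (g x)).
  by apply/funext => t; rewrite raddfD.
by apply: cvgD; [exact: f2|exact: g2].
Qed.

Lemma ccontM f g : ccont f -> ccont g -> ccont (fun x => f x * g x).
Proof.
move=> [f1 f2] [g1 g2]; split => x.
  have -> : (fun x => Re (f x * g x)) = (fun x => Re (f x) * Re (g x) - Im (f x) * Im (g x)).
    by apply/funext => t; rewrite ReM.
  by apply: cvgB; apply: cvgM; [exact: f1|exact: g1|exact: f2|exact: g2].
have -> : (fun x => Im (f x * g x)) = (fun x => Re (f x) * Im (g x) + Im (f x) * Re (g x)).
  by apply/funext => t; rewrite ImM.
by apply: cvgD; apply: cvgM; [exact: f1|exact: g2|exact: f2|exact: g1].
Qed.

Lemma ccontZ c f : ccont f -> ccont (fun x => c * f x).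
Proof. exact: ccontM (ccont_cst c). Qed.

Lemma ccontN f : ccont f -> ccont (fun x => - f x).
Proof. by move=> cf; apply: ccont_ext (ccontZ (-1) cf) => x; rewrite mulN1r. Qed.

Lemma ccontB f g : ccont f -> ccont g -> ccont (fun x => f x - g x).
Proof. by move=> cf cg; apply: ccontD => //; exact: ccontN. Qed.

Lemma ccont_conj f : ccont f -> ccont (fun x => (f x)^*).
Proof.
move=> [f1 f2]; split => x.
  have -> : (fun x => Re (f x)^*) = (fun x => Re (f x)) by apply/funext => t; case: (f t).
  exact: f1.
have -> : (fun x => Im (f x)^*) = (fun x => - Im (f x)) by apply/funext => t; case: (f t).
by apply: cvgN; exact: f2.
Qed.

Lemma ccont_sum n (F : 'I_n -> R -> R[i]) : (forall i, ccont (F i)) ->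
  ccont (fun x => \sum_(i < n) F i x).
Proof.
elim: n F => [|n ih] F cF.
  by apply: ccont_ext (ccont_cst 0) => x; rewrite big_ord0.
apply: ccont_ext (ccontD (ih (fun i => F (widen_ord (leqnSn n) i)) _) (cF ord_max)) => // x.
by rewrite big_ord_recr.
Qed.

Lemma ccont_norm f : ccont f -> continuous (fun x => N (f x)).
Proof.
move=> [f1 f2] x.
have -> : (fun x => N (f x)) = (fun x => Num.sqrt (Re (f x) * Re (f x) + Im (f x) * Im (f x))).
  by apply/funext => t; case: (f t) => a b; rewrite /= !expr2.
apply: continuous_comp; last exact: sqrt_continuous.
by apply: cvgD; apply: cvgM; [exact: f1|exact: f1|exact: f2|exact: f2].
Qed.

Definition cderiv f x d :=
  is_derive x 1 (fun x => Re (f x)) (Re d) /\ is_derive x 1 (fun x => Im (f x)) (Im d).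

Lemma cderivE f x d d' : cderiv f x d -> d = d' -> cderiv f x d'.
Proof. by move=> h <-. Qed.

Lemma cderiv_ext f g x d : (forall x, f x = g x) -> cderiv f x d -> cderiv g x d.
Proof. by move=> fg; rewrite (_ : f = g)//; exact/funext. Qed.

Lemma cderiv_cst c x : cderiv (fun=> c) x 0.
Proof. by split; exact: is_derive_cst. Qed.

Lemma cderivD f g x d d' : cderiv f x d -> cderiv g x d' ->
  cderiv (fun y => f y + g y) x (d + d').
Proof.
move=> [f1 f2] [g1 g2]; split; rewrite raddfD.
  have -> : (fun y => Re (f y + g y)) = (fun y => Re (f y)) + (fun y => Re (g y)).
    by apply/funext => t; rewrite raddfD.
  exact: is_deriveD.
have -> : (fun y => Im (f y + g y)) = (fun y => Im (f y)) + (fun y => Im (g y)).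
  by apply/funext => t; rewrite raddfD.
exact: is_deriveD.
Qed.

Lemma cderivM f g x d d' : cderiv f x d -> cderiv g x d' ->
  cderiv (fun y => f y * g y) x (d * g x + f x * d').
Proof.
move=> [f1 f2] [g1 g2]; split.
  have -> : (fun y => Re (f y * g y)) = ((fun y => Re (f y)) * (fun y => Re (g y)) -
      (fun y => Im (f y)) * (fun y => Im (g y)))%R.
    by apply/funext => t; rewrite ReM.
  apply: (is_deriveE (is_deriveB (is_deriveM f1 g1) (is_deriveM f2 g2))).
  by rewrite ReD !ReM /GRing.scale/=; ring.
have -> : (fun y => Im (f y * g y)) = ((fun y => Re (f y)) * (fun y => Im (g y)) +
    (fun y => Im (f y)) * (fun y => Re (g y)))%R.
  by apply/funext => t; rewrite ImM.
apply: (is_deriveE (is_deriveD (is_deriveM f1 g2) (is_deriveM f2 g1))).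
by rewrite ImD !ImM /GRing.scale/=; ring.
Qed.

Lemma cderivZ c f x d : cderiv f x d -> cderiv (fun y => c * f y) x (c * d).
Proof.
by move=> h; apply: cderivE (cderivM (cderiv_cst c x) h) _; rewrite mul0r add0r.
Qed.

Lemma cderivN f x d : cderiv f x d -> cderiv (fun y => - f y) x (- d).
Proof.
move=> h; rewrite -mulN1r; apply: cderiv_ext (cderivZ (-1) h) => t.
by rewrite mulN1r.
Qed.

Lemma cderivB f g x d d' : cderiv f x d -> cderiv g x d' ->
  cderiv (fun y => f y - g y) x (d - d').
Proof. by move=> h1 h2; apply: cderivD => //; exact: cderivN. Qed.

Definition cprim f x : R[i] :=
  rprim (fun t => Re (f t)) x +i* rprim (fun t => Im (f t)) x.

Lemma cprim0 f : cprim f 0 = 0.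
Proof. by rewrite /cprim !rprim0. Qed.

Lemma cprim_ccont f : ccont f -> ccont (cprim f).
Proof. by move=> [f1 f2]; split; exact: rprim_continuous. Qed.

Lemma cprim_cderiv f x : ccont f -> 0 < x -> cderiv (cprim f) x (f x).
Proof. by move=> [f1 f2] x0; split; exact: rprim_derive. Qed.

Lemma cprim_FTC2 F f x : ccont F -> ccont f ->
  (forall y, 0 < y -> cderiv F y (f y)) -> 0 <= x -> F x = F 0 + cprim f x.
Proof.
move=> [F1 F2] [f1 f2] dF x0.
apply/eqP; rewrite eq_complex ReD ImD/=; apply/andP; split; apply/eqP.
  by rewrite (rprim_FTC2 F1 f1 _ x0)// => y /dF[].
by rewrite (rprim_FTC2 F2 f2 _ x0)// => y /dF[].
Qed.

Lemma cprim_eq f g x : (forall y, 0 <= y <= x -> f y = g y) -> cprim f x = cprim g x.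
Proof.
by move=> fg; congr Complex; apply: rprim_eq => y /fg ->.
Qed.

Lemma cprimD f g x : ccont f -> ccont g ->
  cprim (fun y => f y + g y) x = cprim f x + cprim g x.
Proof.
move=> [f1 f2] [g1 g2]; apply/eqP; rewrite eq_complex ReD ImD/= -!rprimD//.
by apply/andP; split; apply/eqP; apply: rprim_eq => y _; rewrite ?ReD ?ImD.
Qed.

Lemma cprimZ c f x : ccont f -> cprim (fun y => c * f y) x = c * cprim f x.
Proof.
move=> [f1 f2]; apply/eqP; rewrite eq_complex ReM ImM/=; apply/andP; split; apply/eqP.
  rewrite -!rprimZ// -mulN1r -rprimZ; last by move=> t; apply: cvgM; [exact: cvg_cst|exact: f2].
  rewrite -rprimD; [|by move=> t; apply: cvgM; [exact: cvg_cst|exact: f1]|].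
    by apply: rprim_eq => y _; rewrite ReM mulN1r.
  by move=> t; apply: cvgM; [exact: cvg_cst|apply: cvgM; [exact: cvg_cst|exact: f2]].
rewrite -!rprimZ// -rprimD; last 2 first.
  by move=> t; apply: cvgM; [exact: cvg_cst|exact: f2].
  by move=> t; apply: cvgM; [exact: cvg_cst|exact: f1].
by apply: rprim_eq => y _; rewrite ImM.
Qed.

Lemma cprimB f g x : ccont f -> ccont g ->
  cprim (fun y => f y - g y) x = cprim f x - cprim g x.
Proof.
move=> cf cg; rewrite -[- cprim g x]mulN1r -cprimZ// -cprimD//; last exact: ccontZ.
by apply: cprim_eq => y _; rewrite mulN1r.
Qed.

Lemma cderiv0_cst F x : ccont F -> (forall y, 0 < y -> cderiv F y 0) -> 0 <= x -> F x = F 0.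
Proof.
move=> cF dF x0; rewrite (cprim_FTC2 cF (ccont_cst 0) dF x0).
have -> : cprim (fun=> 0) x = 0 * cprim (fun=> 0) x.
  by rewrite -cprimZ; [apply: cprim_eq => y _; rewrite mulr0|exact: ccont_cst].
by rewrite mul0r addr0.
Qed.

Lemma expR_derive (L x : R) : is_derive x 1 (fun t => expR (L * t)) (L * expR (L * x)).
Proof.
apply: (is_deriveE (@is_derive1_comp _ expR (fun t => L * t) _ _ _ _
  (is_deriveM (is_derive_cst L x 1) (is_derive_id x 1)))).
by rewrite /GRing.scale/= mulr0 addr0 mulr1 mulrC.
Qed.

Lemma expR_scale_continuous (L : R) : continuous (fun t => expR (L * t)).
Proof. by move=> x; exact: is_derive_continuous (expR_derive L x). Qed.

Lemma rprim_expR (b L x : R) : 0 < L -> 0 <= x ->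
  rprim (fun y => b * expR (L * y)) x = b / L * (expR (L * x) - 1).
Proof.
move=> L0 x0; rewrite rprimZ; last exact: expR_scale_continuous.
have c1 : continuous (fun y => L^-1 * expR (L * y)).
  by move=> t; apply: cvgM; [exact: cvg_cst|exact: expR_scale_continuous].
have d1 y : 0 < y -> is_derive y 1 (fun y => L^-1 * expR (L * y)) (expR (L * y)).
  move=> _; apply: (is_deriveE (is_deriveM (is_derive_cst L^-1 y 1) (expR_derive L y))).
  by rewrite /GRing.scale/= mulr0 addr0 mulrA mulVf ?mul1r// gt_eqF.
have := rprim_FTC2 c1 (@expR_scale_continuous L) d1 x0.
rewrite mulr0 expR0 mulr1 => hE.
have -> : rprim (fun y => expR (L * y)) x = L^-1 * expR (L * x) - L^-1.
  by rewrite hE addrAC subrr add0r.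
by ring.
Qed.

(** In the norm weighted by exp (- L x), integration gains 1 / L and loses 2 by the split into real
    and imaginary parts. A large [L] makes integration a contraction. *)
Lemma cprim_norm_le f (b L x : R) : ccont f -> 0 <= b -> 0 < L -> 0 <= x ->
  (forall y, 0 <= y <= x -> N (f y) <= b * expR (L * y)) ->
  N (cprim f x) <= 2 * b / L * expR (L * x).
Proof.
move=> [f1 f2] b0 L0 x0 h.
have cg : continuous (fun y => b * expR (L * y)).
  by move=> t; apply: cvgM; [exact: cvg_cst|exact: expR_scale_continuous].
have key (g : R -> R) : continuous g -> (forall y, `|g y| <= N (f y)) ->
    `|rprim g x| <= b / L * expR (L * x).
  move=> cg' hg.
  have bL : 0 <= b / L by rewrite divr_ge0// ltW.
  have hI := rprim_expR b L0 x0.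
  have u1 : rprim g x <= rprim (fun y => b * expR (L * y)) x.
    apply: rprim_le => // y yx.
    by rewrite (le_trans (ler_norm _))// (le_trans (hg y))// h.
  have u2 : rprim (fun y => -1 * g y) x <= rprim (fun y => b * expR (L * y)) x.
    apply: rprim_le => //.
      by move=> t; apply: cvgM; [exact: cvg_cst|exact: cg'].
    move=> y yx; rewrite mulN1r.
    by rewrite (le_trans (ler_norm _))// normrN (le_trans (hg y))// h.
  move: u1 u2; rewrite (rprimZ (-1) x cg') mulN1r hI => u1 u2.
  by rewrite ler_norml; apply/andP; split; lra.
rewrite (le_trans (normc_le_ReIm _))//=.
have := key _ f1 (fun y => Re_le_normc _).
have := key _ f2 (fun y => Im_le_normc _).
lra.
Qed.

Definition cexp z : R[i] := (expR (Re z) * cos (Im z)) +i* (expR (Re z) * sin (Im z)).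

Lemma cexpD z w : cexp (z + w) = cexp z * cexp w.
Proof.
apply/eqP; rewrite eq_complex ReM ImM/= ReD ImD expRD cosD sinD.
by apply/andP; split; apply/eqP; ring.
Qed.

Lemma cexp0 : cexp 0 = 1.
Proof. by rewrite /cexp/= expR0 cos0 sin0 mulr1 mulr0. Qed.

Lemma normc_cexp z : N (cexp z) = expR (Re z).
Proof.
apply/eqP; rewrite -(@eqrXn2 _ 2)// ?normc_ge0 ?expR_ge0// normc_sqr/=.
by rewrite !exprMn -mulrDr cos2Dsin2 mulr1.
Qed.

Lemma cexp_derive z x : cderiv (fun t => cexp (z * t%:C)) x (z * cexp (z * x%:C)).
Proof.
have hR t : Re (z * t%:C) = Re z * t by rewrite ReM/= mulr0 subr0.
have hI t : Im (z * t%:C) = Im z * t by rewrite ImM/= mulr0 add0r.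
have dc (L : R) : is_derive x 1 (fun t => cos (L * t)) (- L * sin (L * x)).
  apply: (is_deriveE (@is_derive1_comp _ cos (fun t => L * t) _ _ _ _
    (is_deriveM (is_derive_cst L x 1) (is_derive_id x 1)))).
  by rewrite /GRing.scale/= mulr0 addr0 mulr1 mulrC mulrN mulNr.
have ds (L : R) : is_derive x 1 (fun t => sin (L * t)) (L * cos (L * x)).
  apply: (is_deriveE (@is_derive1_comp _ sin (fun t => L * t) _ _ _ _
    (is_deriveM (is_derive_cst L x 1) (is_derive_id x 1)))).
  by rewrite /GRing.scale/= mulr0 addr0 mulr1 mulrC.
split.
  have -> : (fun t => Re (cexp (z * t%:C))) =
     ((fun t => expR (Re z * t)) * (fun t => cos (Im z * t)))%R.
    by apply/funext => t; rewrite /cexp hR hI.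
  apply: (is_deriveE (is_deriveM (expR_derive _ _) (dc _))).
  by rewrite ReM /cexp hR hI /GRing.scale/=; ring.
have -> : (fun t => Im (cexp (z * t%:C))) =
   ((fun t => expR (Re z * t)) * (fun t => sin (Im z * t)))%R.
  by apply/funext => t; rewrite /cexp hR hI.
apply: (is_deriveE (is_deriveM (expR_derive _ _) (ds _))).
by rewrite ImM /cexp hR hI /GRing.scale/=; ring.
Qed.

Lemma cexp_ccont z : ccont (fun t => cexp (z * t%:C)).
Proof. by split => x; have [h1 h2] := cexp_derive z x; exact: is_derive_continuous. Qed.

End ComplexCalculus.

(** * Fundamental solutions of the Dirac system, variation of parameters, uniqueness *)

Section DiracSystem.
Variable R : realType.
Variable m : R.
Implicit Types (x y : R) (l : R[i]).

Definition kappa l : R[i] := m%:C ^+ 2 - l ^+ 2.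
Definition rho l : R[i] := sqrtc (kappa l).
(** Even in [rho], hence insensitive to the branch of the root and entire in [l]. *)
Definition dcosh l x : R[i] := 2^-1 * (cexp (rho l * x%:C) + cexp (- rho l * x%:C)).
(* sinh (rho x) / rho, without dividing by rho, which may vanish *)
Definition dsinh l : R -> R[i] := cprim (dcosh l).

Lemma rho_sqr l : rho l * rho l = kappa l.
Proof. by rewrite -expr2 /rho sqr_sqrtc. Qed.

Lemma normc_rho_sqr l : N (rho l) ^+ 2 = N (kappa l).
Proof. by rewrite -normcX expr2 rho_sqr. Qed.

Lemma dcosh_ccont l : ccont (dcosh l).
Proof. by apply: ccontZ; apply: ccontD; exact: cexp_ccont. Qed.

Lemma dsinh_ccont l : ccont (dsinh l).
Proof. exact: cprim_ccont (dcosh_ccont l). Qed.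

Lemma dcosh0 l : dcosh l 0 = 1.
Proof.
rewrite /dcosh (_ : (0 : R)%:C = 0)// !mulr0 cexp0.
by rewrite -[1 + 1]/2%:R mulVf// pnatr_eq0.
Qed.

Lemma dsinh0 l : dsinh l 0 = 0.
Proof. exact: cprim0. Qed.

Lemma dsinh_cderiv l x : 0 < x -> cderiv (dsinh l) x (dcosh l x).
Proof. by move=> x0; apply: cprim_cderiv => //; exact: dcosh_ccont. Qed.

(** Both sides vanish at 0 and have the same derivative. *)
Lemma rho_dsinh l x : 0 <= x ->
  rho l * dsinh l x = 2^-1 * (cexp (rho l * x%:C) - cexp (- rho l * x%:C)).
Proof.
move=> x0; apply/eqP; rewrite -subr_eq0; apply/eqP.
pose F y := rho l * dsinh l y - 2^-1 * (cexp (rho l * y%:C) - cexp (- rho l * y%:C)).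
have cF : ccont F.
  apply: ccontB; first by apply: ccontZ; exact: dsinh_ccont.
  by apply: ccontZ; apply: ccontB; exact: cexp_ccont.
have dF y : 0 < y -> cderiv F y 0.
  move=> y0; apply: cderivE (cderivB (cderivZ _ (dsinh_cderiv l y0))
    (cderivZ _ (cderivB (cexp_derive _ _) (cexp_derive _ _)))) _.
  by rewrite /dcosh; ring.
rewrite -[LHS]/(F x) (cderiv0_cst cF dF x0) /F dsinh0 (_ : (0 : R)%:C = 0)//.
by rewrite !mulr0 cexp0 subrr mulr0 subrr.
Qed.

Lemma dcosh_cderiv l x : 0 < x -> cderiv (dcosh l) x (kappa l * dsinh l x).
Proof.
move=> x0; have -> : kappa l * dsinh l x = rho l * (rho l * dsinh l x).
  by rewrite mulrA rho_sqr.
rewrite rho_dsinh; last exact: ltW.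
apply: (cderivE (cderivZ 2^-1 (cderivD (cexp_derive (rho l) x) (cexp_derive (- rho l) x)))).
by ring.
Qed.

Lemma dcosh_sub_dsinh l x : 0 <= x -> dcosh l x - rho l * dsinh l x = cexp (- rho l * x%:C).
Proof.
by move=> x0; rewrite rho_dsinh// /dcosh; field.
Qed.

(** This is the Wronskian chi1 phi2 - phi1 chi2; its being 1 keeps denominators out of the variation
    of parameters. *)
Lemma dcosh2_dsinh2 l x : 0 <= x -> dcosh l x ^+ 2 - kappa l * dsinh l x ^+ 2 = 1.
Proof.
move=> x0.
have -> : kappa l * dsinh l x ^+ 2 = (rho l * dsinh l x) ^+ 2.
  by rewrite exprMn [rho l ^+ 2]expr2 rho_sqr.
rewrite subr_sqr dcosh_sub_dsinh// rho_dsinh// /dcosh.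
transitivity (cexp (rho l * x%:C) * cexp (- rho l * x%:C)); first by field.
by rewrite -cexpD mulNr subrr cexp0.
Qed.

Lemma normc_dcosh l x : 0 <= x -> N (dcosh l x) <= expR (N (rho l) * x).
Proof.
move=> x0.
have h z : N z = N (rho l) -> N (cexp (z * x%:C)) <= expR (N (rho l) * x).
  move=> <-; rewrite normc_cexp ler_expR ReM/= mulr0 subr0 ler_wpM2r//.
  by rewrite (le_trans (ler_norm _)) ?Re_le_normc.
rewrite /dcosh Normc.normcM; have -> : N (2^-1 : R[i]) = 2^-1.
  have -> : (2^-1 : R[i]) = (2^-1)%:C by rewrite fmorphV rmorph_nat.
  by rewrite normcR ger0_norm.
rewrite ler_pdivrMl//; apply: (le_trans (normcD _ _)).
have := h _ erefl; have := h _ (normcN _); lra.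
Qed.

(** The fundamental system of f1' = (l + m) f2, f2' = (m - l) f1, normalized at 0 by phi = (0, 1)
    and chi = (1, 0). *)
Definition phi1 l x := (l + m%:C) * dsinh l x.
Definition phi2 l x := dcosh l x.
Definition chi1 l x := dcosh l x.
Definition chi2 l x := (m%:C - l) * dsinh l x.

Lemma kappaE l : kappa l = (l + m%:C) * (m%:C - l).
Proof. by rewrite /kappa; ring. Qed.

Lemma phi1_ccont l : ccont (phi1 l).
Proof. by apply: ccontZ; exact: dsinh_ccont. Qed.
Lemma phi2_ccont l : ccont (phi2 l).
Proof. exact: dcosh_ccont. Qed.
Lemma chi1_ccont l : ccont (chi1 l).
Proof. exact: dcosh_ccont. Qed.
Lemma chi2_ccont l : ccont (chi2 l).
Proof. by apply: ccontZ; exact: dsinh_ccont. Qed.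

(** Bilinear on purpose: without conjugation, pairings with phi and chi remain analytic in [l]. *)
Definition dpair (f1 f2 h1 h2 : R -> R[i]) x := f1 x * h1 x + f2 x * h2 x.

Lemma dpair_ccont f1 f2 h1 h2 : ccont f1 -> ccont f2 -> ccont h1 -> ccont h2 ->
  ccont (dpair f1 f2 h1 h2).
Proof. by move=> *; apply: ccontD; apply: ccontM. Qed.

Section VariationOfParameters.
Variables (h1 h2 : R -> R[i]).
Hypotheses (ch1 : ccont h1) (ch2 : ccont h2).

Definition phi_int l := cprim (dpair (phi1 l) (phi2 l) h1 h2).
Definition chi_int l := cprim (dpair (chi1 l) (chi2 l) h1 h2).
(** The first component vanishes at 0 for every [b], which is the value of the second one there;
    decay at infinity will select [b]. *)
Definition sol1 l b x := chi1 l x * phi_int l x + phi1 l x * (b - chi_int l x).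
Definition sol2 l b x := chi2 l x * phi_int l x + phi2 l x * (b - chi_int l x).

Lemma phi_pair_ccont l : ccont (dpair (phi1 l) (phi2 l) h1 h2).
Proof. by apply: dpair_ccont => //; [exact: phi1_ccont|exact: phi2_ccont]. Qed.

Lemma chi_pair_ccont l : ccont (dpair (chi1 l) (chi2 l) h1 h2).
Proof. by apply: dpair_ccont => //; [exact: chi1_ccont|exact: chi2_ccont]. Qed.

Lemma phi_int_ccont l : ccont (phi_int l).
Proof. exact: cprim_ccont (phi_pair_ccont l). Qed.

Lemma chi_int_ccont l : ccont (chi_int l).
Proof. exact: cprim_ccont (chi_pair_ccont l). Qed.

Lemma sol1_ccont l b : ccont (sol1 l b).
Proof.
apply: ccontD; apply: ccontM; [exact: chi1_ccont|exact: phi_int_ccont|exact: phi1_ccont|].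
by apply: ccontB; [exact: ccont_cst|exact: chi_int_ccont].
Qed.

Lemma sol2_ccont l b : ccont (sol2 l b).
Proof.
apply: ccontD; apply: ccontM; [exact: chi2_ccont|exact: phi_int_ccont|exact: phi2_ccont|].
by apply: ccontB; [exact: ccont_cst|exact: chi_int_ccont].
Qed.

Lemma sol10 l b : sol1 l b 0 = 0.
Proof. by rewrite /sol1 /phi_int cprim0 /phi1 dsinh0 !mulr0 mul0r addr0. Qed.

Lemma sol1_cderiv l b x : 0 < x -> cderiv (sol1 l b) x ((l + m%:C) * sol2 l b x + h2 x).
Proof.
move=> x0.
have dA := cprim_cderiv (phi_pair_ccont l) x0; have dB := cprim_cderiv (chi_pair_ccont l) x0.
apply: cderivE (cderivD (cderivM (dcosh_cderiv l x0) dA)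
  (cderivM (cderivZ (l + m%:C) (dsinh_cderiv l x0)) (cderivB (cderiv_cst b x) dB))) _.
have w := dcosh2_dsinh2 l (ltW x0).
rewrite /sol2 /dpair /phi1 /phi2 /chi1 /chi2 -/(phi_int l x) -/(chi_int l x).
(* The coefficient 1 of [h2] is replaced by the Wronskian, after which the identity is purely
   polynomial. *)
rewrite -[X in _ = _ + X]mul1r -w kappaE.
by ring.
Qed.

Lemma sol2_cderiv l b x : 0 < x -> cderiv (sol2 l b) x ((m%:C - l) * sol1 l b x - h1 x).
Proof.
move=> x0.
have dA := cprim_cderiv (phi_pair_ccont l) x0; have dB := cprim_cderiv (chi_pair_ccont l) x0.
apply: cderivE (cderivD (cderivM (cderivZ (m%:C - l) (dsinh_cderiv l x0)) dA)
  (cderivM (dcosh_cderiv l x0) (cderivB (cderiv_cst b x) dB))) _.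
have w := dcosh2_dsinh2 l (ltW x0).
rewrite /sol1 /dpair /phi1 /phi2 /chi1 /chi2 -/(phi_int l x) -/(chi_int l x).
rewrite -[X in _ = _ - X]mul1r -w kappaE.
by ring.
Qed.

End VariationOfParameters.

(* With V = Im (d1 conj d2) and q = |d1|^2 + |d2|^2 one has V' = Im l * q and
   2 |V| <= q, so q grows unless it vanishes. *)
Lemma dirac_uniqueness (l : R[i]) (d1 d2 : R -> R[i]) (K : R) :
  0 < Im l -> ccont d1 -> ccont d2 -> d1 0 = 0 ->
  (forall x, 0 < x -> cderiv d1 x ((l + m%:C) * d2 x)) ->
  (forall x, 0 < x -> cderiv d2 x ((m%:C - l) * d1 x)) ->
  (forall x, 0 <= x -> rprim (fun y => N (d1 y) ^+ 2 + N (d2 y) ^+ 2) x <= K) ->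
  forall x, 0 <= x -> d1 x = 0 /\ d2 x = 0.
Proof.
move=> l0 c1 c2 d10 e1 e2 hK.
pose q (y : R) : R := N (d1 y) ^+ 2 + N (d2 y) ^+ 2.
have cq : continuous q.
  move=> y; rewrite /q; apply: cvgD; apply: cvgM; exact: ccont_norm.
pose V y := Im (d1 y) * Re (d2 y) - Re (d1 y) * Im (d2 y).
have qE y : q y = Re (d1 y) ^+ 2 + Im (d1 y) ^+ 2 + (Re (d2 y) ^+ 2 + Im (d2 y) ^+ 2).
  by rewrite /q !normc_sqr.
have q0 y : 0 <= q y by rewrite /q addr_ge0 ?sqr_ge0.
have VE y : 0 <= y -> V y = Im l * rprim q y.
  move=> y0.
  have cV : continuous V.
    by move=> t; apply: cvgB; apply: cvgM; [exact: c1.2|exact: c2.1|exact: c1.1|exact: c2.2].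
  have clq : continuous (fun y => Im l * q y).
    by move=> t; apply: cvgM; [exact: cvg_cst|exact: cq].
  have dV (z : R) : 0 < z -> is_derive z 1 V (Im l * q z).
    move=> z0; have [a1 a2] := e1 _ z0; have [b1 b2] := e2 _ z0.
    apply: (is_deriveE (is_deriveB (is_deriveM a2 b1) (is_deriveM a1 b2))).
    rewrite qE !(ReM, ImM, ReD, ImD)/= /GRing.scale/=.
    case: (l) (d1 z) (d2 z) => [la lb] [x1 y1] [x2 y2] /=.
    by ring.
  have := rprim_FTC2 cV clq dV y0; rewrite rprimZ// => ->.
  by rewrite /V d10 !mul0r subrr add0r.
have Q0 y : 0 <= y -> 0 <= rprim q y.
  by move=> y0; rewrite -(rprim0 q); apply: rprim_ndecr => //; rewrite lexx.
have qQ y : 0 <= y -> 2 * (Im l * rprim q y) <= q y.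
  move=> y0; rewrite -VE// qE /V.
  have := sqr_ge0 (Im (d1 y) - Re (d2 y)); have := sqr_ge0 (Re (d1 y) + Im (d2 y)).
  by nra.
have Qz x : 0 <= x -> rprim q x = 0.
  move=> x0; apply/eqP; rewrite eq_le Q0// andbT leNgt; apply/negP => Qx.
  pose eta := 2 * (Im l * rprim q x).
  have eta0 : 0 < eta by rewrite !mulr_gt0.
  have K0 : 0 <= K by apply: le_trans (hK 0 _) => //; rewrite rprim0.
  (* Past x one has q >= eta, so the primitive of q gains at least K + 1 between x and X and would
     exceed K. *)
  pose X := x + (K + 1) / eta.
  have xX : x <= X by rewrite lerDl divr_ge0//; [lra|exact: ltW].
  pose g (y : R) : R := rprim q y - eta * y.
  have dg (y : R) : 0 < y -> is_derive y 1 g (q y - eta).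
    move=> y0.
    apply: (is_deriveE (is_deriveB (rprim_derive cq y0)
      (is_deriveM (is_derive_cst eta y 1) (is_derive_id y 1)))).
    by rewrite /GRing.scale/= mulr0 addr0 mulr1.
  have : g x <= g X.
    apply: (@ger0_derive1_le_cc _ g x X).
    - move=> y; rewrite in_itv/= => /andP[xy _].
      by have h := dg _ (le_lt_trans x0 xy); exact: ex_derive.
    - move=> y; rewrite in_itv/= => /andP[xy _].
      have y0 := le_lt_trans x0 xy.
      have h := dg _ y0; rewrite derive1E derive_val subr_ge0.
      apply: le_trans (qQ _ (ltW y0)); rewrite /eta ler_pM2l// ler_pM2l//.
      by apply: rprim_ndecr => //; rewrite x0 ltW.
    - apply: continuous_subspaceT => y; apply: cvgB; first exact: rprim_continuous.
      by apply: cvgM; [exact: cvg_cst|exact: cvg_id].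
    - by rewrite in_itv/= lexx xX.
    - by rewrite in_itv/= lexx xX.
    - exact: xX.
  rewrite /g /X; have := hK X (le_trans x0 xX); rewrite -/q /X.
  rewrite mulrDr [eta * ((K + 1) / eta)]mulrC divfK ?gt_eqF//.
  have := Q0 _ x0; lra.
have qz (x : R) : 0 < x -> q x = 0.
  move=> x0; have h := rprim_derive cq x0.
  have h0 : is_derive x 1 (rprim q) 0.
    apply: (@near_eq_is_derive _ _ _ (cst 0)).
    near=> y; rewrite Qz//; apply: ltW; near: y; exact: lt_nbhsr.
  by rewrite -(@derive_val _ _ _ _ _ _ _ h) (@derive_val _ _ _ _ _ _ _ h0).
have dz (x : R) : 0 < x -> d1 x = 0 /\ d2 x = 0.
  move=> /qz /eqP; rewrite /q paddr_eq0 ?sqr_ge0// !sqrf_eq0 !normc_eq0.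
  by move=> /andP[/eqP -> /eqP ->].
move=> x; rewrite le_eqVlt => /predU1P[<-|/dz//]; split=> //.
have [_ <-] := dz 1 ltr01.
(* Unlike [d1], [d2] has no prescribed value at 0; it vanishes there because it is constant on the
   half-line. *)
apply/esym; apply: (@cderiv0_cst _ d2) => // y y0.
by apply: cderivE (e2 _ y0) _; have [-> _] := dz _ y0; rewrite mulr0.
Unshelve. all: by end_near. Qed.

End DiracSystem.

(** * Square integrability, integrals of compactly supported functions, extension from the
    half-line *)

Section SquareIntegrability.
Variable R : realType.
Local Notation mu := (@lebesgue_measure R).
Implicit Types (f g : R -> R[i]).

Lemma continuous_measurable (D : set R) (f : R -> R) : measurable D ->
  continuous f -> measurable_fun D f.
Proof.
by move=> mD cf; apply: subspace_continuous_measurable_fun => //; exact: continuous_subspaceT.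
Qed.

Lemma measurable_Rplus : measurable (@Rplus R).
Proof. exact: measurable_itv. Qed.

Lemma ReB (z w : R[i]) : Re (z - w) = Re z - Re w.
Proof. by case: z; case: w. Qed.

Lemma ImB (z w : R[i]) : Im (z - w) = Im z - Im w.
Proof. by case: z; case: w. Qed.

Lemma RplusP (x : R) : Rplus x <-> 0 <= x.
Proof. by rewrite /Rplus/= in_itv/= andbT. Qed.

Lemma in_Rplus (x : R) : (x \in @Rplus R) = (0 <= x).
Proof. by apply/idP/idP => [|h]; [rewrite inE => /RplusP|rewrite inE; apply/RplusP]. Qed.

Lemma L2_ext f g : (forall x, 0 <= x -> f x = g x) -> L2 f -> L2 g.
Proof.
move=> fg [f1 f2 f3]; split.
- by apply: eq_measurable_fun f1 => x; rewrite in_Rplus => /fg ->.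
- by apply: eq_measurable_fun f2 => x; rewrite in_Rplus => /fg ->.
- apply: eq_integrable f3; first exact: measurable_Rplus.
  by move=> x; rewrite in_Rplus => /fg ->.
Qed.

Lemma integrable_expR (b : R) : 0 < b ->
  mu.-integrable (@Rplus R) (fun x => (expR (- b * x))%:E).
Proof.
move=> b0.
have h : mu.-integrable (@Rplus R) (EFin \o exponential_pdf b).
  by apply: integrableS (integrable_exponential_pdf b0) => //; exact: measurable_Rplus.
have {}h : mu.-integrable (@Rplus R) (fun x => b^-1%:E * (exponential_pdf b x)%:E)%E.
  by apply: integrableZl => //; exact: measurable_Rplus.
apply: eq_integrable h; first exact: measurable_Rplus.
move=> x; rewrite in_Rplus => x0.
rewrite /exponential_pdf patchE mem_set/=; last by rewrite in_itv/= andbT.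
by rewrite -EFinM mulrA mulVf ?mul1r// gt_eqF.
Qed.

Lemma L2_decay f (K b M : R) : ccont f -> 0 < b -> 0 <= M ->
  (forall x, M <= x -> N (f x) <= K * expR (- b * x)) -> L2 f.
Proof.
move=> cf b0 M0 hK; have [f1 f2] := cf.
split; [exact: continuous_measurable measurable_Rplus f1|
        exact: continuous_measurable measurable_Rplus f2|].
have cN : continuous (fun x => N (f x) * expR (b * x)).
  by move=> x; apply: cvgM; [exact: ccont_norm|exact: expR_scale_continuous].
have [c cM hc] := EVT_max M0 (continuous_subspaceT cN (A := `[0, M])).
pose L := `|K| + `|N (f c) * expR (b * c)|.
have L0 : 0 <= L by rewrite addr_ge0.
have hL x : 0 <= x -> N (f x) <= L * expR (- b * x).
  move=> x0; have e0 : 0 <= expR (- b * x) by exact: expR_ge0.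
  have [xM|Mx] := leP x M.
    have := hc x; rewrite in_itv/= x0 xM => /(_ isT) h.
    rewrite mulNr expRN ler_pdivlMr ?expR_gt0//.
    by rewrite (le_trans h)// (le_trans (ler_norm _))// lerDr.
  rewrite (le_trans (hK _ (ltW Mx)))// ler_wpM2r//.
  by rewrite (le_trans (ler_norm _))// lerDl.
have b20 : 0 < b + b by rewrite addr_gt0.
have h : mu.-integrable (@Rplus R) (fun x => (L ^+ 2)%:E * (expR (- (b + b) * x))%:E)%E.
  by apply: integrableZl; [exact: measurable_Rplus|exact: integrable_expR].
apply: le_integrable h; first exact: measurable_Rplus.
  apply/measurable_EFinP; apply: continuous_measurable; first exact: measurable_Rplus.
  by move=> x; apply: cvgD; apply: cvgM; [exact: f1|exact: f1|exact: f2|exact: f2].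
move=> x /RplusP x0; rewrite /=.
rewrite lee_fin -normc_sqr ger0_norm ?sqr_ge0// ger0_norm; last first.
  by rewrite mulr_ge0 ?sqr_ge0 ?expR_ge0.
have -> : expR (- (b + b) * x) = expR (- b * x) ^+ 2.
  by rewrite expr2 -expRD -mulrDl -opprD.
by rewrite -exprMn lerXn2r ?nnegrE ?normc_ge0 ?mulr_ge0 ?expR_ge0// hL.
Qed.

(** Translates membership in L^2 into the bounded primitives that [dirac_uniqueness] consumes. *)
Lemma L2_rprim_bounded f g : ccont g -> (forall x, 0 <= x -> f x = g x) -> L2 f ->
  exists K, forall x, rprim (fun y => N (g y) ^+ 2) x <= K.
Proof.
move=> cg fg /(L2_ext fg)[_ _ hi].
exists (\int[mu]_(x in @Rplus R) (N (g x) ^+ 2)) => x.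
have mN D : measurable D -> measurable_fun D (fun y => (N (g y) ^+ 2)%:E).
  move=> mD; apply/measurable_EFinP; apply: continuous_measurable => // t.
  by apply: cvgM; exact: ccont_norm.
have {}hi : mu.-integrable (@Rplus R) (fun y => (N (g y) ^+ 2)%:E).
  apply: eq_integrable hi; first exact: measurable_Rplus.
  by move=> y _; rewrite normc_sqr.
have sub : `[0, x]%classic `<=` @Rplus R.
  by apply: subset_itvl; rewrite bnd_simp.
rewrite /rprim /Rintegral; apply: fine_le.
- apply: integrable_fin_num => //.
  by apply: integrableS hi => //; exact: measurable_Rplus.
- by apply: integrable_fin_num => //; exact: measurable_Rplus.
- apply: ge0_subset_integral => //; first exact: measurable_Rplus.
    exact: mN measurable_Rplus.
  by move=> y _; rewrite lee_fin sqr_ge0.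
Qed.

Lemma rintegral_support (D : set R) (f : R -> R) (M : R) :
  `[0, M] `<=` D -> (forall x, D x -> 0 <= x) -> (forall x, M < x -> f x = 0) ->
  \int[mu]_(x in D) f x = rprim f M.
Proof.
move=> sD D0 fM; rewrite /rprim Rintegral_mkcond [RHS]Rintegral_mkcond.
apply: eq_Rintegral => x _; rewrite !patchE.
have [xM|xM] := boolP (x \in `[0, M]%classic).
  by rewrite mem_set//; apply: sD; rewrite inE in xM.
case: ifPn => // xD; apply: fM.
rewrite ltNge; apply/negP => h; move/negP: xM; apply; rewrite inE/= in_itv/= h andbT.
by apply: D0; rewrite inE in xD.
Qed.

Lemma cintegral_Rplus f g (M : R) : 0 <= M -> (forall x, 0 <= x -> f x = g x) ->
  (forall x, M < x -> g x = 0) -> cintegral (@Rplus R) f = cprim g M.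
Proof.
move=> M0 fg gM.
have sub : `[0, M]%classic `<=` @Rplus R.
  by apply: subset_itvl; rewrite bnd_simp.
have pos x : @Rplus R x -> 0 <= x by move=> /RplusP.
rewrite /cintegral /cprim; congr Complex.
  rewrite -(rintegral_support sub pos) => [|x /gM ->//].
  by apply: eq_Rintegral => x; rewrite inE => /pos /fg ->.
rewrite -(rintegral_support sub pos) => [|x /gM ->//].
by apply: eq_Rintegral => x; rewrite inE => /pos /fg ->.
Qed.

Lemma cprim_support f (M x : R) : M <= x -> 0 <= M -> (forall x, M < x -> f x = 0) ->
  cprim f x = cprim f M.
Proof.
move=> Mx M0 fM.
have sub : `[0, M]%classic `<=` `[0, x]%classic by apply: subset_itvl; rewrite bnd_simp.
have pos y : `[0, x]%classic y -> 0 <= y by rewrite /= in_itv/= => /andP[].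
by rewrite /cprim; congr Complex; apply: (rintegral_support sub pos) => y /fM ->.
Qed.

Lemma cintegrable_ccont f (x : R) : ccont f -> cintegrable `[0, x] f.
Proof. by move=> [f1 f2]; split; exact: continuous_integrable_itv. Qed.

(* Composing with [max 0] turns continuity on the half-line into continuity. *)
Definition clip f (x : R) : R[i] := f (Num.max x 0).

Lemma clip_ge0 f x : 0 <= x -> clip f x = f x.
Proof. by move=> x0; rewrite /clip max_l. Qed.

Lemma clip_continuous (f : R -> R) :
  (forall y, 0 <= y -> forall e : R, 0 < e -> exists2 d : R, 0 < d &
     forall t, 0 <= t -> `|t - y| < d -> `|f t - f y| < e) ->
  continuous (fun x : R => f (Num.max x 0)).
Proof.
move=> h x; apply/cvgrPdist_lt => e e0.
have [d d0 hd] := h (Num.max x 0) ltac:(by rewrite le_max lexx orbT) _ e0.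
near=> t; rewrite distrC; apply: hd; first by rewrite le_max lexx orbT.
apply: (@le_lt_trans _ _ `|x - t|).
  rewrite [leRHS]distrC; case: (leP t 0); case: (leP x 0) => hx ht.
  - by rewrite subrr normr0.
  - rewrite sub0r normrN gtr0_norm//; rewrite ler0_norm; lra.
  - rewrite subr0 gtr0_norm//; rewrite ger0_norm; lra.
  - by [].
near: t; apply/nbhs_ballP; exists d => //.
Unshelve. all: by end_near. Qed.

Lemma clip_ccont f :
  {within @Rplus R, continuous (f : R -> R[i]^o)} -> ccont (clip f).
Proof.
move=> /subspace_continuousP cf.
have key y : 0 <= y -> forall e : R, 0 < e -> exists2 d : R, 0 < d &
     forall t, 0 <= t -> `|t - y| < d -> N (f t - f y) < e.
  move=> y0 e e0.
  have yR : @Rplus R y by apply/RplusP.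
  have /(cf y yR) : nbhs (f y : R[i]^o) [set w | N (w - f y) < e].
    by apply/near_normc; exists e.
  rewrite /= /within/= => /nbhs_ballP[d /= d0 hd]; exists d => // t t0 ty.
  by apply: hd; [rewrite -ball_normE/= distrC|apply/RplusP].
split.
  apply: (clip_continuous (f := fun t => Re (f t))) => y y0 e e0.
  have [d d0 hd] := key y y0 e e0; exists d => // t t0 ty.
  have := hd _ t0 ty; apply: le_lt_trans.
  by rewrite -ReB; exact: Re_le_normc.
apply: (clip_continuous (f := fun t => Im (f t))) => y y0 e e0.
have [d d0 hd] := key y y0 e e0; exists d => // t t0 ty.
have := hd _ t0 ty; apply: le_lt_trans.
by rewrite -ImB; exact: Im_le_normc.
Qed.

Lemma C0_spinor_clip (h : @spinor R) : C0_spinor h ->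
  [/\ ccont (clip h.1), ccont (clip h.2) &
   exists M, [/\ 0 <= M, forall x, M < x -> clip h.1 x = 0 &
     forall x, M < x -> clip h.2 x = 0]].
Proof.
move=> [h1 h2 [M hM]]; split; [exact: clip_ccont|exact: clip_ccont|].
exists (Num.max M 0); split=> [|x|x]; first by rewrite le_max lexx orbT.
  by rewrite gt_max => /andP[/hM[h10 _] x0]; rewrite clip_ge0 ?ltW.
by rewrite gt_max => /andP[/hM[_ h20] x0]; rewrite clip_ge0 ?ltW.
Qed.

Lemma rprim_clip_continuous (g : R -> R) :
  (forall b, 0 <= b -> mu.-integrable `[0, b] (fun x => (g x)%:E)) ->
  continuous (fun x : R => rprim g (Num.max x 0)).
Proof.
move=> hg; apply: clip_continuous => y y0 e e0.
have y1 : 0 <= y + 1 by lra.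
have /subspace_continuousP := parameterized_integral_continuous y1 (hg _ y1).
have yI : `[0, y + 1]%classic y by rewrite /= in_itv/= y0/=; lra.
move=> /(_ y yI) /cvgrPdist_lt /(_ _ e0).
rewrite /= near_withinE => /nbhs_ballP[d /= d0 hd].
exists (Num.min d 1); first by rewrite lt_min d0 ltr01.
move=> t t0; rewrite lt_min => /andP[td t1].
rewrite distrC; apply: hd; first by rewrite -ball_normE/= distrC.
rewrite /= in_itv/= t0/=; move: t1; rewrite ltr_norml => /andP[]; lra.
Qed.

End SquareIntegrability.

(** * The resolvent in the upper half-plane and its explicit quadratic form *)

Section FreeResolvent.
Variable R : realType.
Local Notation mu := (@lebesgue_measure R).
Variable m : R.

Lemma sqrtc_Re_ge0 (z : R[i]) : 0 <= Re (sqrtc z).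
Proof. by case: z => a b; rewrite /= sqrtr_ge0. Qed.

(** If Re rho = 0, then m^2 - l^2 is real and nonpositive. Its vanishing imaginary part forces Re l
    = 0, and then it equals m^2 + (Im l)^2 > 0. *)
Lemma rho_Re_gt0 (l : R[i]) : 0 < m -> 0 < Im l -> 0 < Re (rho m l).
Proof.
move=> m0 l0; rewrite lt_neqAle sqrtc_Re_ge0 andbT eq_sym; apply/eqP => r0.
have := rho_sqr m l; case E : (rho m l) r0 => [a b] /= -> {E a}.
move=> hr; have hR := congr1 (@complex.Re R) hr; have hI := congr1 (@complex.Im R) hr.
move: hR hI; rewrite /kappa !expr2; case: l l0 {hr} => [x y] /= y0.
rewrite !(mulr0, mul0r, addr0, sub0r, subr0, oppr0) => hR hI.
have x0 : x = 0 by nra.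
by move: hR; rewrite x0; nra.
Qed.

Lemma addm_neq0 (l : R[i]) : 0 < Im l -> l + m%:C != 0.
Proof.
move=> l0; apply/eqP => h; have : Im (l + m%:C) = 0 by rewrite h.
by rewrite ImD/= addr0 => h'; rewrite h' ltxx in l0.
Qed.

(** The Weyl coefficient: chi + gamma phi is the decaying solution exp (- rho x) (1, gamma). *)
Definition gamma (l : R[i]) := - rho m l / (l + m%:C).

Lemma chi1_gamma l x : 0 <= x -> 0 < Im l ->
  chi1 m l x + gamma l * phi1 m l x = cexp (- rho m l * x%:C).
Proof.
move=> x0 l0; rewrite -dcosh_sub_dsinh// /chi1 /phi1 /gamma mulNr.
by rewrite mulrA mulNr divfK ?addm_neq0// mulNr.
Qed.

Lemma chi2_gamma l x : 0 <= x -> 0 < Im l ->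
  chi2 m l x + gamma l * phi2 m l x = gamma l * cexp (- rho m l * x%:C).
Proof.
move=> x0 l0; rewrite -dcosh_sub_dsinh// /chi2 /phi2 mulrBr addrC; congr (_ + _).
have -> : gamma l * (rho m l * dsinh m l x) =
    - (rho m l * rho m l * dsinh m l x / (l + m%:C)) by rewrite /gamma; ring.
by rewrite opprK rho_sqr kappaE; field; exact: addm_neq0.
Qed.

Section Data.
Variables (h : @spinor R) (k1 k2 : R -> R[i]) (M : R).
Hypotheses (ck1 : ccont k1) (ck2 : ccont k2) (M0 : 0 <= M).
Hypotheses (hk1 : forall x, 0 <= x -> h.1 x = k1 x)
           (hk2 : forall x, 0 <= x -> h.2 x = k2 x).
Hypotheses (k1M : forall x, M < x -> k1 x = 0) (k2M : forall x, M < x -> k2 x = 0).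

(** Beyond the support of the data both integrals are constant, and this value of [b] leaves a
    multiple of chi + gamma phi, with no growing part. *)
Definition beta l := chi_int m k1 k2 l M + gamma l * phi_int m k1 k2 l M.
Let f1 l := sol1 m k1 k2 l (beta l).
Let f2 l := sol2 m k1 k2 l (beta l).

Lemma sol1_far l x : 0 < Im l -> M <= x ->
  f1 l x = phi_int m k1 k2 l M * cexp (- rho m l * x%:C).
Proof.
move=> l0 Mx; have x0 := le_trans M0 Mx.
rewrite /f1 /sol1 /beta.
have -> : phi_int m k1 k2 l x = phi_int m k1 k2 l M.
  by apply: cprim_support => // y My; rewrite /dpair k1M// k2M// !mulr0 addr0.
have -> : chi_int m k1 k2 l x = chi_int m k1 k2 l M.
  by apply: cprim_support => // y My; rewrite /dpair k1M// k2M// !mulr0 addr0.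
by rewrite -chi1_gamma//; ring.
Qed.

Lemma sol2_far l x : 0 < Im l -> M <= x ->
  f2 l x = phi_int m k1 k2 l M * (gamma l * cexp (- rho m l * x%:C)).
Proof.
move=> l0 Mx; have x0 := le_trans M0 Mx.
rewrite /f2 /sol2 /beta.
have -> : phi_int m k1 k2 l x = phi_int m k1 k2 l M.
  by apply: cprim_support => // y My; rewrite /dpair k1M// k2M// !mulr0 addr0.
have -> : chi_int m k1 k2 l x = chi_int m k1 k2 l M.
  by apply: cprim_support => // y My; rewrite /dpair k1M// k2M// !mulr0 addr0.
by rewrite -chi2_gamma//; ring.
Qed.

Lemma normc_psi l x : N (cexp (- rho m l * x%:C)) = expR (- Re (rho m l) * x).
Proof. by rewrite normc_cexp ReM/= mulr0 subr0; case: (rho m l). Qed.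

Lemma f1_ccont l : ccont (f1 l). Proof. exact: sol1_ccont. Qed.
Lemma f2_ccont l : ccont (f2 l). Proof. exact: sol2_ccont. Qed.

Hypothesis m0 : 0 < m.

Lemma sol_L2 l : 0 < Im l -> L2 (f1 l) /\ L2 (f2 l).
Proof.
move=> l0; split.
  apply: (@L2_decay _ _ (N (phi_int m k1 k2 l M)) (Re (rho m l)) M) => //.
  - exact: f1_ccont.
  - exact: rho_Re_gt0.
  - by move=> x Mx; rewrite sol1_far// Normc.normcM normc_psi.
apply: (@L2_decay _ _ (N (phi_int m k1 k2 l M) * N (gamma l)) (Re (rho m l)) M) => //.
- exact: f2_ccont.
- exact: rho_Re_gt0.
- by move=> x Mx; rewrite sol2_far// !Normc.normcM normc_psi mulrA.
Qed.

Lemma rhs_L2 (f k : R -> R[i]) (g : R -> R[i]) (l : R[i]) (K : R) : 0 < Im l ->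
  ccont f -> ccont k -> (forall x, 0 <= x -> g x = k x) -> (forall x, M < x -> k x = 0) ->
  (forall x, M <= x -> N (f x) <= K * expR (- Re (rho m l) * x)) ->
  L2 (fun x => l * f x + g x).
Proof.
move=> l0 cf ck gk kM hf.
apply: (@L2_ext _ (fun x => l * f x + k x)) => [x /gk -> //|].
(* [kM] is strict, so the decay is claimed from M + 1 on, where k surely vanishes. *)
apply: (@L2_decay _ _ (N l * K) (Re (rho m l)) (M + 1)).
- by apply: ccontD => //; exact: ccontZ.
- exact: rho_Re_gt0.
- by rewrite addr_ge0.
- move=> x Mx; rewrite kM; last lra.
  rewrite addr0 Normc.normcM -mulrA ler_wpM2l ?normc_ge0//.
  by apply: hf; lra.
Qed.

Lemma free_dirac_sol l : 0 < Im l ->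
  free_dirac m (f1 l, f2 l) (fun x => l * f1 l x + h.1 x, fun x => l * f2 l x + h.2 x).
Proof.
move=> l0; have [L1 L2'] := sol_L2 l0; split.
- by [].
- split.
    apply: (@rhs_L2 _ k1 _ _ (N (phi_int m k1 k2 l M))) => //; first exact: f1_ccont.
    by move=> x Mx; rewrite sol1_far// Normc.normcM normc_psi.
  apply: (@rhs_L2 _ k2 _ _ (N (phi_int m k1 k2 l M) * N (gamma l))) => //; first exact: f2_ccont.
  by move=> x Mx; rewrite sol2_far// !Normc.normcM normc_psi mulrA.
- exact: sol10.
- pose g1 x := (l + m%:C) * f2 l x + k2 x.
  pose g2 x := (m%:C - l) * f1 l x - k1 x.
  have cg1 : ccont g1 by apply: ccontD => //; apply: ccontZ; exact: f2_ccont.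
  have cg2 : ccont g2 by apply: ccontB => //; apply: ccontZ; exact: f1_ccont.
  exists (g1, g2); split.
  + split=> [b _|x x0]; first exact: cintegrable_ccont.
    by apply: (cprim_FTC2 (f1_ccont l) cg1 _ x0) => y y0; exact: sol1_cderiv.
  + split=> [b _|x x0]; first exact: cintegrable_ccont.
    by apply: (cprim_FTC2 (f2_ccont l) cg2 _ x0) => y y0; exact: sol2_cderiv.
  + apply: aeW => x /RplusP x0 /=; rewrite hk1// hk2// /g1 /g2.
    by split; ring.
Qed.

Lemma ac_derivative_clip (f g : R -> R[i]) : ac_derivative f g -> ccont (clip f).
Proof.
move=> [hg hf].
have fE x : clip f x = f 0 + cprim g (Num.max x 0).
  by rewrite /clip hf ?le_max ?lexx ?orbT.
split.
  have -> : (fun x => Re (clip f x)) =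
    (fun x => Re (f 0) + rprim (fun t => Re (g t)) (Num.max x 0)).
    by apply/funext => x; rewrite fE ReD.
  move=> x; apply: cvgD; first exact: cvg_cst.
  by apply: rprim_clip_continuous => b /hg[].
have -> : (fun x => Im (clip f x)) =
  (fun x => Im (f 0) + rprim (fun t => Im (g t)) (Num.max x 0)).
  by apply/funext => x; rewrite fE ImD.
move=> x; apply: cvgD; first exact: cvg_cst.
by apply: rprim_clip_continuous => b /hg[].
Qed.

Lemma ae_imply (P Q : R -> Prop) : (forall x, P x -> Q x) ->
  {ae mu, forall x, P x} -> {ae mu, forall x, Q x}.
Proof. by move=> PQ; apply: filterS; first exact: (ae_filter_ringOfSetsType mu). Qed.

Lemma rprim_ae (u v : R -> R) (x : R) : mu.-integrable `[0, x] (fun t => (u t)%:E) ->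
  continuous v -> {ae mu, forall t, Rplus t -> u t = v t} -> rprim u x = rprim v x.
Proof.
move=> iu cv uv; rewrite /rprim /Rintegral; congr fine; apply: ae_eq_integral => //.
- exact: measurable_int iu.
- exact: measurable_int (continuous_integrable_itv 0 x cv).
- apply: ae_imply uv => t ht /=; rewrite in_itv/= => /andP[t0 _].
  by congr EFin; apply: ht; apply/RplusP.
Qed.

(** Regularity: if the almost everywhere derivative agrees with a continuous function, then [f] is a
    primitive of that function, hence classically differentiable. *)
Lemma clip_cderiv (f g G : R -> R[i]) : ac_derivative f g -> ccont G ->
  {ae mu, forall t, Rplus t -> g t = G t} ->
  forall x, 0 < x -> cderiv (clip f) x (G x).
Proof.
move=> [hg hf] cG gG x x0.
have fE y : 0 <= y -> clip f y = f 0 + cprim G y.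
  move=> y0; rewrite clip_ge0// hf//; congr (_ + _).
  have [i1 i2] := hg _ y0; have [c1 c2] := cG.
  rewrite /cintegral /cprim; congr Complex; apply: rprim_ae => //.
    by apply: ae_imply gG => t ht /ht ->.
  by apply: ae_imply gG => t ht /ht ->.
have dG := cderivD (cderiv_cst (f 0) x) (cprim_cderiv cG x0).
have nearE : \near x, f 0 + cprim G x = clip f x.
  near=> y; rewrite fE//; apply: ltW; near: y; exact: lt_nbhsr.
rewrite add0r in dG; case: dG => d1 d2; split.
  apply: near_eq_is_derive d1; near=> y; congr Re; near: y; exact: nearE.
apply: near_eq_is_derive d2; near=> y; congr Im; near: y; exact: nearE.
Unshelve. all: by end_near. Qed.

Lemma normcB_sqr (z w : R[i]) : N (z - w) ^+ 2 <= 2 * N z ^+ 2 + 2 * N w ^+ 2.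
Proof.
have := normcB z w; have := normc_ge0 z; have := normc_ge0 w; have := normc_ge0 (z - w).
have := sqr_ge0 (N z - N w); nra.
Qed.

(** The difference of two solutions solves the homogeneous system classically and is square
    integrable, so it vanishes. This is what identifies the spinor chosen by [resolvent], at every
    point of the half-line. *)
Lemma free_dirac_unique l (f : @spinor R) : 0 < Im l ->
  free_dirac m f (fun x => l * f.1 x + h.1 x, fun x => l * f.2 x + h.2 x) ->
  forall x, 0 <= x -> f.1 x = f1 l x /\ f.2 x = f2 l x.
Proof.
move=> l0 [[L1 L2'] _ f10 [[g1 g2] /= [ac1 ac2 ae]]].
have c1 := ac_derivative_clip ac1; have c2 := ac_derivative_clip ac2.
pose G1 x := (l + m%:C) * clip f.2 x + k2 x.
pose G2 x := (m%:C - l) * clip f.1 x - k1 x.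
have cG1 : ccont G1 by apply: ccontD => //; exact: ccontZ.
have cG2 : ccont G2 by apply: ccontB => //; exact: ccontZ.
have aeG1 : {ae mu, forall t, Rplus t -> g1 t = G1 t}.
  apply: ae_imply ae => t ht tR; have [_ h2] := ht tR.
  have t0 : 0 <= t by apply/RplusP.
  rewrite /G1 clip_ge0// -hk2//.
  by rewrite mulrDl addrAC h2 subrK.
have aeG2 : {ae mu, forall t, Rplus t -> g2 t = G2 t}.
  apply: ae_imply ae => t ht tR; have [h1 _] := ht tR.
  have t0 : 0 <= t by apply/RplusP.
  rewrite /G2 clip_ge0// -hk1// mulrBl -addrA -opprD h1.
  by rewrite opprB addrCA subrr addr0.
pose d1 x := clip f.1 x - f1 l x; pose d2 x := clip f.2 x - f2 l x.
have [K1 hK1] := L2_rprim_bounded c1 (fun x x0 => esym (clip_ge0 f.1 x0)) L1.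
have [K2 hK2] := L2_rprim_bounded c2 (fun x x0 => esym (clip_ge0 f.2 x0)) L2'.
have [S1 S2] := sol_L2 l0.
have [K3 hK3] := L2_rprim_bounded (f1_ccont l) (fun x _ => erefl) S1.
have [K4 hK4] := L2_rprim_bounded (f2_ccont l) (fun x _ => erefl) S2.
have csq (v : R -> R[i]) : ccont v -> continuous (fun x => N (v x) ^+ 2).
  by move=> cf t; apply: cvgM; exact: ccont_norm.
have csq2 (v : R -> R[i]) : ccont v -> continuous (fun x => 2 * N (v x) ^+ 2).
  by move=> cf t; apply: cvgM; [exact: cvg_cst|exact: csq].
have cd1 : ccont d1 by apply: ccontB => //; exact: f1_ccont.
have cd2 : ccont d2 by apply: ccontB => //; exact: f2_ccont.
have csum (u v : R -> R) : continuous u -> continuous v -> continuous (fun x => u x + v x).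
  by move=> cu cv t; apply: cvgD; [exact: cu|exact: cv].
have uniq := @dirac_uniqueness _ m l d1 d2 (2 * K1 + 2 * K3 + (2 * K2 + 2 * K4)) l0 cd1 cd2.
have {}uniq : forall x, 0 <= x -> d1 x = 0 /\ d2 x = 0.
  apply: uniq.
  - by rewrite /d1 clip_ge0// f10 /f1 sol10 subrr.
  - move=> x x0; apply: cderivE (cderivB (clip_cderiv ac1 cG1 aeG1 x0)
      (sol1_cderiv m ck1 ck2 l (beta l) x0)) _.
    by rewrite /G1 /d2 /f2; ring.
  - move=> x x0; apply: cderivE (cderivB (clip_cderiv ac2 cG2 aeG2 x0)
      (sol2_cderiv m ck1 ck2 l (beta l) x0)) _.
    by rewrite /G2 /d1 /f1; ring.
  - move=> x x0.
    apply: (@le_trans _ _ (rprim (fun y => (2 * N (clip f.1 y) ^+ 2 + 2 * N (f1 l y) ^+ 2) +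
       (2 * N (clip f.2 y) ^+ 2 + 2 * N (f2 l y) ^+ 2)) x)).
      apply: rprim_le.
      + by apply: (csum); exact: csq.
      + by apply: (csum); apply: (csum); apply: (csq2) => //; [exact: f1_ccont|exact: f2_ccont].
      + by move=> y _; apply: lerD; exact: normcB_sqr.
    have s1 := f1_ccont l; have s2 := f2_ccont l.
    rewrite rprimD; [|by apply: (csum); exact: csq2|by apply: (csum); exact: csq2].
    rewrite rprimD; [|exact: csq2|exact: csq2].
    rewrite [X in _ + X]rprimD; [|exact: csq2|exact: csq2].
    rewrite !rprimZ; [|exact: csq|exact: csq|exact: csq|exact: csq].
    have := hK1 x; have := hK2 x; have := hK3 x; have := hK4 x; lra.
move=> x x0; have [h1 h2] := uniq _ x0.
move: h1 h2; rewrite /d1 /d2 !clip_ge0// => /eqP + /eqP.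
by rewrite !subr_eq0 => /eqP -> /eqP ->.
Qed.

Lemma resolventE l x : 0 < Im l -> 0 <= x ->
  (resolvent (free_dirac m) l h).1 x = f1 l x /\
  (resolvent (free_dirac m) l h).2 x = f2 l x.
Proof.
move=> l0 x0; apply: free_dirac_unique => //.
apply: (@xgetPex _ _ [set f : @spinor R | free_dirac m f
  (fun x => l * f.1 x + h.1 x, fun x => l * f.2 x + h.2 x)]).
by exists (f1 l, f2 l); exact: free_dirac_sol.
Qed.

Let j1 x := (k1 x)^*.
Let j2 x := (k2 x)^*.

(** The solution is affine in [b] with slope phi. The summand of [beta] without [gamma] gives this
    entire part; the other one contributes [gamma] times [rank_one_part]. *)
Definition regular_part l :=
  cprim (dpair (sol1 m k1 k2 l (chi_int m k1 k2 l M)) (sol2 m k1 k2 l (chi_int m k1 k2 l M))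
    j1 j2) M.

Definition rank_one_part l := phi_int m k1 k2 l M * phi_int m j1 j2 l M.

Lemma resolvent_formE l : 0 < Im l ->
  resolvent_form (free_dirac m) h l = regular_part l + gamma l * rank_one_part l.
Proof.
move=> l0; rewrite /resolvent_form /inner.
have cj1 : ccont j1 by exact: ccont_conj.
have cj2 : ccont j2 by exact: ccont_conj.
rewrite (@cintegral_Rplus _ _ (dpair (f1 l) (f2 l) j1 j2) M)//; last 2 first.
- by move=> x x0; have [-> ->] := resolventE l0 x0; rewrite hk1// hk2.
- by move=> x Mx; rewrite /dpair /j1 /j2 k1M// k2M// !rmorph0 !mulr0 addr0.
rewrite /regular_part /rank_one_part mulrA /phi_int -cprimZ; last first.
  by apply: dpair_ccont => //; [exact: phi1_ccont|exact: phi2_ccont].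
rewrite -cprimD; last 2 first.
- by apply: dpair_ccont => //; [exact: sol1_ccont|exact: sol2_ccont].
- by apply: ccontZ; apply: dpair_ccont => //; [exact: phi1_ccont|exact: phi2_ccont].
apply: cprim_eq => y _; rewrite /dpair /f1 /f2 /sol1 /sol2 /beta -/(phi_int m k1 k2 l M).
by ring.
Qed.

End Data.
End FreeResolvent.

(** * Polynomial approximation in [l], uniform in the integration variable *)

Section ParametricApproximation.
Variable R : realType.
Implicit Types (P Q : R -> {poly R[i]}) (F G : R -> R[i] -> R[i]).

(** Polynomials in [l] depending continuously on x. The uniform bound on the degree lets integration
    in x act coefficient by coefficient. *)
Definition polyx P := (exists n, forall x, (size (P x) <= n)%N) /\
  forall j, ccont (fun x => (P x)`_j).

Lemma polyx_cst (p : {poly R[i]}) : polyx (fun=> p).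
Proof. by split=> [|j]; [exists (size p)|exact: ccont_cst]. Qed.

Lemma polyx_coef (q : R -> R[i]) : ccont q -> polyx (fun x => (q x)%:P).
Proof.
move=> cq; split=> [|j]; first by exists 1%N => x; exact: size_polyC_leq1.
case: j => [|j]; first by apply: ccont_ext cq => x; rewrite coefC.
by apply: ccont_ext (ccont_cst 0) => x; rewrite coefC.
Qed.

Lemma polyxD P Q : polyx P -> polyx Q -> polyx (fun x => P x + Q x).
Proof.
move=> [[a ha] cP] [[b hb] cQ]; split.
  exists (maxn a b) => x; rewrite (leq_trans (size_polyD _ _))//.
  by rewrite geq_max !leq_max ha hb orbT.
by move=> j; apply: ccont_ext (ccontD (cP j) (cQ j)) => x; rewrite coefD.
Qed.

Lemma polyxM P Q : polyx P -> polyx Q -> polyx (fun x => P x * Q x).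
Proof.
move=> [[a ha] cP] [[b hb] cQ]; split.
  exists (a + b)%N => x; rewrite (leq_trans (size_polyMleq _ _))//.
  by rewrite (leq_trans (leq_pred _))// leq_add.
move=> j; apply: ccont_ext; last first.
  by apply: (@ccont_sum _ _ (fun i x => (P x)`_i * (Q x)`_(j - i))) => i; exact: ccontM.
by move=> x; rewrite coefM.
Qed.

Lemma ccont_horner P l : polyx P -> ccont (fun x => (P x).[l]).
Proof.
move=> [[n hn] cP]; apply: ccont_ext; last first.
  by apply: (@ccont_sum _ n (fun i x => (P x)`_i * l ^+ i)) => i; apply: ccontM => //; exact: ccont_cst.
by move=> x; rewrite (horner_coef_wide _ (hn x)).
Qed.

Lemma cprim_sum n (c : 'I_n -> R[i]) (q : 'I_n -> R -> R[i]) x :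
  (forall i, ccont (q i)) ->
  cprim (fun t => \sum_(i < n) q i t * c i) x = \sum_(i < n) cprim (q i) x * c i.
Proof.
elim: n c q => [|n ih] c q cq.
  rewrite [RHS]big_ord0 -[RHS](mul0r (cprim (fun=> 0) x)) -cprimZ; last exact: ccont_cst.
  by apply: cprim_eq => t _; rewrite big_ord0 mul0r.
rewrite big_ord_recr/= -ih// mulrC -cprimZ// -cprimD; last 2 first.
- by apply: ccont_sum => i; apply: ccontM => //; exact: ccont_cst.
- exact: ccontZ.
by apply: cprim_eq => t _; rewrite big_ord_recr/= [c ord_max * _]mulrC.
Qed.

Lemma polyx_prim P : polyx P ->
  exists2 Q, polyx Q & forall x l, (Q x).[l] = cprim (fun t => (P t).[l]) x.
Proof.
move=> [[n hn] cP]; exists (fun x => \poly_(j < n) cprim (fun t => (P t)`_j) x).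
  split=> [|j]; first by exists n => x; exact: size_poly.
  have [jn|jn] := ltnP j n.
    by apply: ccont_ext (cprim_ccont (cP j)) => x; rewrite coef_poly jn.
  by apply: ccont_ext (ccont_cst 0) => x; rewrite coef_poly ltnNge jn.
move=> x l; rewrite horner_poly.
rewrite -(@cprim_sum n (fun j => l ^+ j) (fun j t => (P t)`_j))//.
by apply: cprim_eq => t _; rewrite (horner_coef_wide _ (hn t)).
Qed.

Variables (M r : R).
Hypotheses (M0 : 0 <= M) (r0 : 0 <= r).

Lemma polyx_bounded P : polyx P ->
  exists2 B, 0 <= B & forall x l, 0 <= x <= M -> N l <= r -> N (P x).[l] <= B.
Proof.
move=> [[n hn] cP].
have /choice[c hc] j : exists c, forall x, 0 <= x <= M -> N (P x)`_j <= c.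
  have [c _ hc] := EVT_max M0 (continuous_subspaceT (ccont_norm (cP j)) (A := `[0, M])).
  by exists (N (P c)`_j) => x xM; apply: hc; rewrite in_itv/=.
have c0 j : 0 <= c j.
  by apply: le_trans (hc j 0 _); [exact: normc_ge0|rewrite lexx M0].
exists (\sum_(j < n) c j * r ^+ j).
  by apply: sumr_ge0 => j _; rewrite mulr_ge0// exprn_ge0.
move=> x l xM lr; rewrite (horner_coef_wide _ (hn x)) (le_trans (normc_sum _ _ _))//.
apply: ler_sum => j _; rewrite Normc.normcM normcX ler_pM ?exprn_ge0 ?normc_ge0 ?hc//.
by rewrite lerXn2r ?nnegrE ?normc_ge0.
Qed.

Definition unifapprox F := (forall l, ccont (F ^~ l)) /\
  forall e, 0 < e -> exists2 P, polyx P &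
    forall x l, 0 <= x <= M -> N l <= r -> N (F x l - (P x).[l]) <= e.

Lemma unifapprox_bounded F : unifapprox F ->
  exists2 B, 0 <= B & forall x l, 0 <= x <= M -> N l <= r -> N (F x l) <= B.
Proof.
move=> [_ /(_ _ ltr01)[P cP hP]]; have [B B0 hB] := polyx_bounded cP.
exists (B + 1) => [|x l xM lr]; first lra.
have := hP x l xM lr; have := hB x l xM lr.
have := normc_subl (F x l) (P x).[l]; lra.
Qed.

Lemma unifapprox_polyx P : polyx P -> unifapprox (fun x l => (P x).[l]).
Proof.
move=> cP; split=> [l|e e0]; first exact: ccont_horner.
by exists P => // x l _ _; rewrite subrr Normc.normc0 ltW.
Qed.

Lemma unifapprox_ext F G : (forall x l, F x l = G x l) -> unifapprox F -> unifapprox G.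
Proof. by move=> FG; rewrite (_ : F = G)//; apply/funext => x; apply/funext => l. Qed.

Lemma unifapprox_horner (p : {poly R[i]}) : unifapprox (fun _ l => p.[l]).
Proof. exact: unifapprox_polyx (polyx_cst p). Qed.

Lemma unifapprox_coef (q : R -> R[i]) : ccont q -> unifapprox (fun x _ => q x).
Proof.
move=> cq; apply: unifapprox_ext (unifapprox_polyx (polyx_coef cq)) => x l.
by rewrite hornerC.
Qed.

Lemma unifapproxD F G : unifapprox F -> unifapprox G ->
  unifapprox (fun x l => F x l + G x l).
Proof.
move=> [cF hF] [cG hG]; split=> [l|e e0]; first exact: ccontD.
have e2 : 0 < e / 2 by lra.
have [P cP hP] := hF _ e2; have [Q cQ hQ] := hG _ e2.
exists (fun x => P x + Q x) => [|x l xM lr]; first exact: polyxD.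
rewrite hornerD opprD addrACA (le_trans (normcD _ _))//.
have := hP x l xM lr; have := hQ x l xM lr; lra.
Qed.

Lemma unifapproxM F G : unifapprox F -> unifapprox G ->
  unifapprox (fun x l => F x l * G x l).
Proof.
move=> hF hG.
have [A A0 hA] := unifapprox_bounded hF; have [B B0 hB] := unifapprox_bounded hG.
case: hF hG => [cF hF] [cG hG].
split=> [l|e e0]; first exact: ccontM.
pose e1 := Num.min 1 (e / (A + B + 1)).
have e10 : 0 < e1 by rewrite lt_min ltr01 divr_gt0//; lra.
have e11 : e1 <= 1 by rewrite ge_min lexx.
have e1e : e1 * (A + B + 1) <= e.
  by rewrite -ler_pdivlMr; [rewrite ge_min lexx orbT|lra].
have [P cP hP] := hF _ e10; have [Q cQ hQ] := hG _ e10.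
exists (fun x => P x * Q x) => [|x l xM lr]; first exact: polyxM.
rewrite hornerM.
have -> : F x l * G x l - (P x).[l] * (Q x).[l] =
  F x l * (G x l - (Q x).[l]) + (F x l - (P x).[l]) * (Q x).[l] by ring.
rewrite (le_trans (normcD _ _))// !Normc.normcM.
have hQw : N (Q x).[l] <= B + 1.
  have := normc_subl (Q x).[l] (G x l); rewrite normc_distC.
  by have := hQ x l xM lr; have := hB x l xM lr; lra.
have k1 : N (F x l) * N (G x l - (Q x).[l]) <= A * e1.
  by apply: ler_pM; rewrite ?normc_ge0 ?hA ?hQ.
have k2 : N (F x l - (P x).[l]) * N (Q x).[l] <= e1 * (B + 1).
  by apply: ler_pM; rewrite ?normc_ge0 ?hP.
lra.
Qed.

Lemma unifapproxN F : unifapprox F -> unifapprox (fun x l => - F x l).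
Proof.
move=> hF; apply: unifapprox_ext (unifapproxM (unifapprox_horner (-1)%:P) hF) => x l.
by rewrite hornerC mulN1r.
Qed.

Lemma unifapproxB F G : unifapprox F -> unifapprox G ->
  unifapprox (fun x l => F x l - G x l).
Proof. by move=> hF hG; apply: unifapproxD => //; exact: unifapproxN. Qed.

Lemma unifapprox_prim F : unifapprox F ->
  unifapprox (fun x l => cprim (F ^~ l) x).
Proof.
move=> [cF hF]; split=> [l|e e0]; first exact: cprim_ccont.
have E0 : 0 < expR M :> R by exact: expR_gt0.
(* [cprim_norm_le] with weight exponent 1 costs at most a factor 2 exp M on [0, M]. *)
have e1 : 0 < e / (2 * expR M) by rewrite divr_gt0// mulr_gt0.
have [P cP hP] := hF _ e1; have [Q cQ hQ] := polyx_prim cP.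
exists Q => // x l /andP[x0 xM] lr; rewrite hQ -cprimB//; last exact: ccont_horner.
apply: (@le_trans _ _ (2 * (e / (2 * expR M)) / 1 * expR (1 * x))).
  apply: cprim_norm_le => //; [|exact: ltW|].
    by apply: ccontB => //; exact: ccont_horner.
  move=> y /andP[y0 yx].
  apply: (@le_trans _ _ (e / (2 * expR M))).
    by apply: hP => //; rewrite y0 (le_trans yx xM).
  rewrite ler_peMr; [by []|exact: ltW|].
  by rewrite mul1r; have := expR_ge1Dx y; lra.
rewrite mul1r divr1.
have h : expR x <= expR M by rewrite ler_expR.
have -> : 2 * (e / (2 * expR M)) = e / expR M.
  by field; rewrite gt_eqF.
by rewrite mulrAC ler_pdivrMr// ler_wpM2l// ltW.
Qed.

Lemma unifapprox_at F : unifapprox F -> unifapprox (fun _ l => F M l).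
Proof.
move=> [cF hF]; split=> [l|e e0]; first exact: ccont_cst.
have [P cP hP] := hF _ e0; exists (fun=> P M) => [|x l _ lr]; first exact: polyx_cst.
by apply: hP; rewrite // M0 lexx.
Qed.

Lemma unifapprox_polapprox F (p : R[i]) (s : R) : unifapprox F -> s + N p <= r ->
  polapprox (F M : R[i]^o -> R[i]^o) p s.
Proof.
move=> [_ hF] sr e e0; have [P cP hP] := hF _ e0; exists (P M) => w ws.
apply: hP; first by rewrite M0 lexx.
by rewrite -{1}(subrK p w) (le_trans (normcD _ _))// (le_trans _ sr)// lerD2r.
Qed.

Variable m : R.

(* Picard iteration of c = 1 + kappa * (double primitive of c), which contracts
   in the norm weighted by exp (- L x). *)
Lemma unifapprox_dcosh : unifapprox (fun x l => dcosh m l x).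
Proof.
split=> [l|e e0]; first exact: dcosh_ccont.
pose K := m ^+ 2 + r ^+ 2.
have K0 : 0 <= K by rewrite addr_ge0 ?sqr_ge0.
(* Two integrations and the factor [kappa] cost 4 K / L^2 <= 1/2. [L] also dominates |rho|, which
   bounds the error of the starting polynomial 0. *)
pose L := 8 * (K + 1).
have L0 : 0 < L by rewrite /L; lra.
have kK l : N l <= r -> N (kappa m l) <= K.
  move=> lr; rewrite (le_trans (normcB _ _))// !normcX normcR real_normK ?num_real//.
  by rewrite lerD2l lerXn2r ?nnegrE ?normc_ge0.
have rL l : N l <= r -> N (rho m l) <= L.
  move=> lr; rewrite -(@ler_pXn2r _ 2)// ?nnegrE ?normc_ge0 ?(ltW L0)// normc_rho_sqr.
  by rewrite (le_trans (kK _ lr))// /L; nra.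
have dE l x : 0 <= x -> dcosh m l x = 1 + kappa m l * cprim (dsinh m l) x.
  move=> x0; rewrite -cprimZ; last exact: dsinh_ccont.
  by rewrite (cprim_FTC2 (dcosh_ccont m l) (ccontZ (kappa m l) (dsinh_ccont m l))
    (fun y => @dcosh_cderiv _ m l y) x0) dcosh0.
have key n : exists2 P, polyx P & forall x l, 0 <= x <= M -> N l <= r ->
    N (dcosh m l x - (P x).[l]) <= 2^-1 ^+ n * expR (L * x).
  elim: n => [|n [P cP hP]].
    exists (fun=> 0) => [|x l /andP[x0 xM] lr]; first exact: polyx_cst.
    rewrite horner0 subr0 expr0 mul1r (le_trans (normc_dcosh _ _ x0))//.
    by rewrite ler_expR ler_wpM2r// rL.
  have [Q cQ hQ] := polyx_prim cP; have [S cS hS] := polyx_prim cQ.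
  exists (fun x => 1 + (((m ^+ 2)%:C)%:P - 'X^2) * S x).
    by apply: polyxD; [exact: polyx_cst|apply: polyxM => //; exact: polyx_cst].
  move=> x l /andP[x0 xM] lr.
  rewrite dE// hornerD hornerM !hornerE hS.
  have -> : 1 + kappa m l * cprim (dsinh m l) x -
      (1 + ((m ^+ 2)%:C - l ^+ 2) * cprim (fun t => (Q t).[l]) x) =
      kappa m l * (cprim (dsinh m l) x - cprim (fun t => (Q t).[l]) x).
    by rewrite /kappa rmorphXn/=; ring.
  have cQl : ccont (fun t => (Q t).[l]) by exact: ccont_horner.
  have cPl : ccont (fun t => (P t).[l]) by exact: ccont_horner.
  rewrite -cprimB//; last exact: dsinh_ccont.
  rewrite Normc.normcM.
  have b0 : 0 <= 2^-1 ^+ n :> R by rewrite exprn_ge0.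
  have h1 y : 0 <= y <= x ->
      N (dsinh m l y - (Q y).[l]) <= 2 * 2^-1 ^+ n / L * expR (L * y).
    move=> /andP[y0 yx]; rewrite hQ -cprimB//; last exact: dcosh_ccont.
    apply: cprim_norm_le => //; first by apply: ccontB => //; exact: dcosh_ccont.
    by move=> z /andP[z0 zy]; apply: hP => //; rewrite z0 (le_trans zy)// (le_trans yx).
  have h2 : N (cprim (fun y => dsinh m l y - (Q y).[l]) x) <=
      2 * (2 * 2^-1 ^+ n / L) / L * expR (L * x).
    apply: cprim_norm_le => //; first by apply: ccontB => //; exact: dsinh_ccont.
    by apply: divr_ge0; [exact: mulr_ge0|exact: ltW].
  apply: (le_trans (ler_pM _ _ (kK _ lr) h2)); rewrite ?normc_ge0//.
  rewrite [K * _]mulrA ler_wpM2r ?expR_ge0// exprS.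
  have -> : K * (2 * (2 * 2^-1 ^+ n / L) / L) = (4 * K / L ^+ 2) * 2^-1 ^+ n.
    by field; rewrite gt_eqF.
  rewrite ler_wpM2r// ler_pdivrMr ?exprn_gt0//.
  by rewrite /L; nra.
have [n hn] : exists n, expR (L * M) < e * n.+1%:R.
  by exists (Num.trunc (expR (L * M) / e)); rewrite [e * _]mulrC -ltr_pdivrMr// truncnS_gt.
have [P cP hP] := key n; exists P => // x l xM lr.
apply: (le_trans (hP x l xM lr)).
apply: (@le_trans _ _ (2^-1 ^+ n * expR (L * M))).
  rewrite ler_wpM2l ?exprn_ge0// ler_expR ler_wpM2l ?(ltW L0)//.
  by case/andP: xM.
rewrite exprVn mulrC ler_pdivrMr ?exprn_gt0// ltW// (lt_le_trans hn)//.
by rewrite ler_wpM2l ?(ltW e0)// -natrX ler_nat; exact: ltn_expl.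
Qed.

Lemma unifapprox_dsinh : unifapprox (fun x l => dsinh m l x).
Proof. exact: unifapprox_prim unifapprox_dcosh. Qed.

Lemma unifapprox_phi1 : unifapprox (fun x l => phi1 m l x).
Proof.
apply: unifapprox_ext (unifapproxM (unifapprox_horner ('X + (m%:C)%:P)) unifapprox_dsinh).
by move=> x l; rewrite !hornerE.
Qed.

Lemma unifapprox_chi2 : unifapprox (fun x l => chi2 m l x).
Proof.
apply: unifapprox_ext (unifapproxM (unifapprox_horner ((m%:C)%:P - 'X)) unifapprox_dsinh).
by move=> x l; rewrite !hornerE.
Qed.

Lemma unifapprox_phi_int k1 k2 : ccont k1 -> ccont k2 ->
  unifapprox (fun x l => phi_int m k1 k2 l x).
Proof.
move=> c1 c2; apply: unifapprox_prim; apply: unifapproxD; apply: unifapproxM;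
  [exact: unifapprox_phi1|exact: unifapprox_coef|exact: unifapprox_dcosh|exact: unifapprox_coef].
Qed.

Lemma unifapprox_chi_int k1 k2 : ccont k1 -> ccont k2 ->
  unifapprox (fun x l => chi_int m k1 k2 l x).
Proof.
move=> c1 c2; apply: unifapprox_prim; apply: unifapproxD; apply: unifapproxM;
  [exact: unifapprox_dcosh|exact: unifapprox_coef|exact: unifapprox_chi2|exact: unifapprox_coef].
Qed.

End ParametricApproximation.

(** * The coefficients of the Green function are entire *)

Section EntireParts.
Variable R : realType.
Variables (m : R) (k1 k2 : R -> R[i]) (M : R).
Hypotheses (ck1 : ccont k1) (ck2 : ccont k2) (M0 : 0 <= M).

Lemma phi_int_polapprox (p : R[i]) s :
  polapprox ((fun l => phi_int m k1 k2 l M) : R[i]^o -> R[i]^o) p s.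
Proof.
(* The uniform approximation lives on discs about 0; this radius covers the disc of radius s about
   p. *)
have r0 : 0 <= `|s| + N p by rewrite addr_ge0 ?normc_ge0.
apply: (unifapprox_polapprox M0 (unifapprox_phi_int M0 r0 m ck1 ck2)).
by rewrite lerD2r ler_norm.
Qed.

Lemma regular_part_polapprox (p : R[i]) s :
  polapprox (regular_part m k1 k2 M : R[i]^o -> R[i]^o) p s.
Proof.
have r0 : 0 <= `|s| + N p by rewrite addr_ge0 ?normc_ge0.
have uA := unifapprox_phi_int M0 r0 m ck1 ck2.
have uB := unifapprox_chi_int M0 r0 m ck1 ck2.
have uD := unifapproxB M0 r0 (unifapprox_at M0 uB) uB.
have uc := unifapprox_dcosh M r0 m.
pose S1 x l := sol1 m k1 k2 l (chi_int m k1 k2 l M) x.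
pose S2 x l := sol2 m k1 k2 l (chi_int m k1 k2 l M) x.
have u1 : unifapprox M (`|s| + N p) S1.
  by apply: (unifapproxD (unifapproxM M0 r0 uc uA) (unifapproxM M0 r0 (unifapprox_phi1 M0 r0 m) uD)).
have u2 : unifapprox M (`|s| + N p) S2.
  by apply: (unifapproxD (unifapproxM M0 r0 (unifapprox_chi2 M0 r0 m) uA) (unifapproxM M0 r0 uc uD)).
have uk k : ccont k -> unifapprox M (`|s| + N p) (fun x _ => (k x)^*).
  by move=> ck; apply: unifapprox_coef => //; exact: ccont_conj.
have := unifapprox_prim (unifapproxD (unifapproxM M0 r0 u1 (uk _ ck1)) (unifapproxM M0 r0 u2 (uk _ ck2))).
by move=> /(unifapprox_polapprox M0); apply; rewrite lerD2r ler_norm.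
Qed.

End EntireParts.

Lemma rank_one_part_polapprox (R : realType) (m : R) (k1 k2 : R -> R[i]) (M : R)
    (p : R[i]) (s : R) : ccont k1 -> ccont k2 -> 0 <= M ->
  polapprox (rank_one_part m k1 k2 M : R[i]^o -> R[i]^o) p s.
Proof.
move=> c1 c2 M0; apply: polapproxM; first exact: phi_int_polapprox.
by apply: phi_int_polapprox => //; exact: ccont_conj.
Qed.

Lemma ReN (R : realType) (z : R[i]) : Re (- z) = - Re z.
Proof. by case: z. Qed.

Lemma ImN (R : realType) (z : R[i]) : Im (- z) = - Im z.
Proof. by case: z. Qed.

(** * Exclusion of all other states, and the bound on the multiplicity *)

Section FreeDiracStates.
Variable R : realType.
Local Notation C := (R[i]^o).
Variable m : R.
Hypothesis m0 : 0 < m.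

Definition green (h : @spinor R) : C -> C := resolvent_form (free_dirac m) h.

Lemma green_decomposition h : C0_spinor h -> exists E P : C -> C,
  [/\ forall p s, polapprox E p s, forall p s, polapprox P p s &
   forall l, 0 < Im l -> green h l = E l + gamma m l * P l].
Proof.
move=> /C0_spinor_clip[c1 c2 [M [M0 h1 h2]]].
exists (regular_part m (clip h.1) (clip h.2) M), (rank_one_part m (clip h.1) (clip h.2) M).
split=> [p s|p s|l l0]; [exact: regular_part_polapprox|exact: rank_one_part_polapprox|].
by apply: resolvent_formE => // x x0; rewrite clip_ge0.
Qed.

Lemma gammaM (l : R[i]) : 0 < Im l -> (l + m%:C) * gamma m l = - rho m l.
Proof. by move=> l0; rewrite /gamma mulrC divfK// addm_neq0. Qed.

Lemma normc_rho_le (l : R[i]) : N (rho m l) <= 1 + N (kappa m l).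
Proof.
have := normc_rho_sqr m l; have := normc_ge0 (rho m l).
have := sqr_ge0 (N (rho m l) - 1); nra.
Qed.

Lemma kappa_bounded (p : R[i]) s :
  exists2 K, 0 <= K & forall w, N (w - p) <= s -> N (kappa m w) <= K.
Proof.
have [K K0 hK] := polapprox_bounded
  (polapprox_horner (((m ^+ 2)%:C)%:P - 'X^2) (p : C) s).
exists K => // w /hK; rewrite !hornerE.
by have -> : kappa m w = (m ^+ 2)%:C - w ^+ 2 by rewrite /kappa rmorphXn.
Qed.

(** Multiplication by w + m clears the denominator of [gamma]: (w + m) G = (w + m) E - rho P, where
    [rho] need only be bounded. *)
Lemma green_bounded h (p : C) (s : R) : C0_spinor h ->
  exists2 B, 0 <= B & forall w, 0 < Im w -> N (w - p) <= s ->
    N (green h w) * N (w + m%:C) <= B.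
Proof.
move=> /green_decomposition[E [P [hE hP hG]]].
have [B1 B10 h1] := polapprox_bounded (polapproxM (polapprox_horner ('X + (m%:C)%:P) p s) (hE p s)).
have [B2 B20 h2] := polapprox_bounded (hP p s).
have [K K0 hK] := kappa_bounded p s.
exists (B1 + (1 + K) * B2); first by rewrite addr_ge0// mulr_ge0//; lra.
move=> w w0 ws; rewrite hG// -Normc.normcM mulrC mulrDr mulrA gammaM//.
rewrite (le_trans (normcD _ _))// lerD//.
  by have := h1 w ws; rewrite !hornerE.
rewrite Normc.normcM normcN ler_pM ?normc_ge0 ?h2//.
by rewrite (le_trans (normc_rho_le _))// lerD2l hK.
Qed.

(** Here l + m = z^2 while rho^2 = z^2 (2 m - z^2), so rho = O(|z|) cancels one of the two powers of
    z. *)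
Lemma green_bounded_bottom h : C0_spinor h ->
  exists B : R, forall z : C, 0 < Im (z ^+ 2) -> N z <= 1 ->
    N (green h (- m%:C + z ^+ 2)) * N z <= B.
Proof.
have m1 := m0; move=> /green_decomposition[E [P [hE hP hG]]].
have [B1 B10 h1] := polapprox_bounded (hE (- m%:C) 1).
have [B2 B20 h2] := polapprox_bounded (hP (- m%:C) 1).
exists (B1 + (2 * m + 2) * B2) => z z0 z1.
set w := - m%:C + z ^+ 2.
have wm : w + m%:C = z ^+ 2 by rewrite /w addrAC addNr add0r.
have w0 : 0 < Im w by rewrite /w ImD/= oppr0 add0r.
have zn0 : z != 0 by apply/eqP => h0; rewrite h0 expr0n/= ltxx in z0.
have Nz0 : 0 < N z by rewrite normc_gt0.
have ws : N (w - - m%:C) <= 1.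
  by rewrite opprK wm normcX exprn_ile1// ltW.
have hr : N (rho m w) <= (2 * m + 2) * N z.
  have c0 : 0 <= 2 * m + 2 by lra.
  rewrite -(@ler_pXn2r _ 2)// ?nnegrE ?normc_ge0 ?mulr_ge0 ?normc_ge0//.
  rewrite normc_rho_sqr kappaE wm Normc.normcM normcX exprMn mulrC.
  rewrite ler_wpM2r ?sqr_ge0//.
  have -> : m%:C - w = (2 * m)%:C - z ^+ 2 by rewrite /w rmorphM rmorph_nat; ring.
  rewrite (le_trans (normcB _ _))// normcR ger0_norm; last by lra.
  have : N (z ^+ 2) <= 1 by rewrite normcX exprn_ile1// ltW.
  by nra.
rewrite hG// -(ler_pM2r Nz0) -mulrA -expr2 -normcX -wm -Normc.normcM.
rewrite mulrC mulrDr mulrA gammaM// (le_trans (normcD _ _))// [leRHS]mulrDl lerD//.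
  have zz : N z ^+ 2 <= N z by rewrite expr2 ger_pMr.
  by rewrite wm Normc.normcM normcX mulrC; apply: ler_pM; rewrite ?normc_ge0 ?sqr_ge0 ?h1.
by rewrite Normc.normcM normcN mulrAC; apply: ler_pM; rewrite ?normc_ge0 ?h2.
Qed.

Lemma imaginary_normc (t : R) : 0 <= t -> N (0 +i* t) = t.
Proof. by move=> t0; rewrite /= expr0n add0r sqrtr_sqr ger0_norm. Qed.

Lemma no_eigenvalue h (p : C) n : C0_spinor h -> rim m p ->
  ~ pole_along C_plus (green h) p n.
Proof.
have m1 := m0; move=> hC [p0 /andP[pm _]] [F1 [/near_normc[r r0 hF] hpole]].
have [B B0 hB] := green_bounded p 1 hC.
(* The distance from p to - m, a lower bound for |w + m| at every w above p. *)
pose c := m + Re p; have c0 : 0 < c by rewrite /c; lra.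
have n0 : (0 < n)%N by case: hpole.
suff : (n <= 0)%N by rewrite leqNgt n0.
apply: (@pole_order_le _ _ _ C_plus _ _ (B / c) hpole) => d d0.
pose t := Num.min (Num.min d r) 1 / 2.
have [t0 td tr t1] : [/\ 0 < t, t < d, t < r & t < 1].
  have h0 : 0 < Num.min (Num.min d r) 1 by rewrite !lt_min d0 r0 ltr01.
  have h1 : Num.min (Num.min d r) 1 <= d by rewrite !ge_min lexx.
  have h2 : Num.min (Num.min d r) 1 <= r by rewrite !ge_min lexx orbT.
  have h3 : Num.min (Num.min d r) 1 <= 1 by rewrite !ge_min lexx orbT.
  by rewrite /t; split; lra.
exists (p + (0 +i* t)).
have wp : p + (0 +i* t) - p = 0 +i* t by rewrite addrC addKr.
have Nw : N (p + (0 +i* t) - p) = t by rewrite wp imaginary_normc// ltW.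
have w0 : 0 < Im (p + (0 +i* t)) by rewrite ImD p0/= add0r.
split.
- by rewrite -subr_eq0 -normc_eq0 Nw gt_eqF.
- by rewrite Nw.
- exact: w0.
- rewrite expr0 mulr1 hF ?Nw//.
  rewrite ler_pdivlMr//.
  apply: le_trans (hB _ w0 _); last by rewrite Nw ltW.
  rewrite ler_wpM2l ?normc_ge0//.
  apply: le_trans (Re_le_normc _); rewrite !ReD/= addr0 ger0_norm /c; lra.
Qed.

(** On the diagonal z^2 is a positive multiple of i, so lambda0 + z^2 lies in C_+ vertically above
    the branch point. *)
Lemma first_quadrant_point (d : R) : 0 < d -> exists t : R,
  [/\ 0 < t, N (t +i* t) < d, N (t +i* t) <= 1, (t +i* t) ^+ 2 = 0 +i* (2 * t ^+ 2) &
   t +i* t != 0].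
Proof.
move=> d0; pose t := Num.min d 1 / 4.
have [t0 td t1] : [/\ 0 < t, 4 * t <= d & 4 * t <= 1].
  have h0 : 0 < Num.min d 1 by rewrite !lt_min d0 ltr01.
  have h1 : Num.min d 1 <= d by rewrite !ge_min lexx.
  have h3 : Num.min d 1 <= 1 by rewrite !ge_min lexx orbT.
  by rewrite /t; split; lra.
have Nt : N (t +i* t) <= 2 * t.
  by rewrite (le_trans (normc_le_ReIm _))//= ger0_norm; [lra|exact: ltW].
exists t; split => //; [lra|lra| |].
- by rewrite !expr2; apply/eqP; rewrite eq_complex ReM ImM/= subrr eqxx/=; apply/eqP; ring.
- by apply/eqP => -[h]; rewrite h ltxx in t0.
Qed.

Lemma no_virtual_state_top h n : C0_spinor h ->
  ~ pole_along first_quadrant (fun z => green h (m%:C + z ^+ 2)) 0 n.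
Proof.
have m1 := m0; move=> hC [F1 [/near_normc[r r0 hF] hpole]].
have [B B0 hB] := green_bounded m%:C 1 hC.
have n0 : (0 < n)%N by case: hpole.
suff : (n <= 0)%N by rewrite leqNgt n0.
apply: (@pole_order_le _ _ _ first_quadrant _ _ (B / (2 * m)) hpole) => d d0.
have [t [t0 td t1 tE tz]] := @first_quadrant_point (Num.min d r) ltac:(by rewrite lt_min d0 r0).
move: td; rewrite lt_min => /andP[td tr].
have fq : first_quadrant (t +i* t : C) by split.
exists (t +i* t); rewrite subr0; split=> //.
have t20 : 0 < t ^+ 2 by rewrite exprn_gt0.
have t21 : N (0 +i* (2 * t ^+ 2)) <= 1 by rewrite -tE normcX exprn_ile1 ?normc_ge0.
rewrite expr0 mulr1 hF ?subr0// ler_pdivlMr; last by lra.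
have w0 : 0 < Im (m%:C + (t +i* t) ^+ 2) by rewrite tE ImD/= add0r; lra.
apply: le_trans (hB _ w0 _); last by rewrite tE addrC addKr.
rewrite ler_wpM2l ?normc_ge0//.
apply: le_trans (Re_le_normc _); rewrite tE !ReD/= addr0 ger0_norm; lra.
Qed.

Lemma virtual_state_bottom_order h n : C0_spinor h ->
  pole_along first_quadrant (fun z => green h (- m%:C + z ^+ 2)) 0 n -> (n <= 1)%N.
Proof.
have m1 := m0; move=> hC [F1 [/near_normc[r r0 hF] hpole]].
have [B hB] := green_bounded_bottom hC.
apply: (@pole_order_le _ _ _ first_quadrant _ _ B hpole) => d d0.
have [t [t0 td t1 tE tz]] := @first_quadrant_point (Num.min d r) ltac:(by rewrite lt_min d0 r0).
move: td; rewrite lt_min => /andP[td tr].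
have fq : first_quadrant (t +i* t : C) by split.
exists (t +i* t); rewrite subr0; split=> //.
rewrite expr1 hF ?subr0//; apply: hB => //.
by rewrite tE/= mulr_gt0// exprn_gt0.
Qed.

Lemma near_punctured_open (Q : C -> Prop) (p : C) : (\forall w \near p^', Q w) ->
  exists2 r : R, 0 < r & forall p' : C, N (p' - p) < r -> \forall w \near p'^', Q w.
Proof.
move=> /near'_normc[r r0 h]; exists (r / 2); first lra.
move=> p' pp; apply/near'_normc.
have [-> |pp0] := eqVneq p' p; first by exists r.
have pp1 : 0 < N (p' - p) by rewrite normc_gt0 subr_eq0.
exists (Num.min (r / 2) (N (p' - p))); first by rewrite lt_min pp1 andbT; lra.
move=> w _; rewrite lt_min => /andP[w1 w2]; apply: h.
  by apply: contraTneq w2 => ->; rewrite normc_distC ltxx.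
have -> : w - p = (w - p') + (p' - p) by rewrite addrA subrK.
by rewrite (le_lt_trans (normcD _ _))//; lra.
Qed.

(* Both alternatives are open conditions on [p], so only one holds along a segment. *)
Lemma punctured_identity (D : set C) (Q : C -> C) (p q : C) :
  (forall w, D w -> (\forall z \near w^', Q z = 0) \/ (\forall z \near w^', Q z != 0)) ->
  (forall t : R, 0 <= t <= 1 -> D (p + t%:C * (q - p))) ->
  (\forall z \near q^', Q z = 0) -> (\forall z \near p^', Q z = 0).
Proof.
move=> dich hD hq.
pose w (t : R) : C := p + t%:C * (q - p).
have wopen (S : C -> Prop) : open [set t : R | \forall z \near (w t)^', S z].
  rewrite openE => t /near_punctured_open[r r0 hr].
  apply/nbhs_ballP; exists (r / (N (q - p) + 1)).
    by rewrite /= divr_gt0//; have := normc_ge0 (q - p); lra.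
  move=> t'; rewrite -ball_normE/= ltr_pdivlMr; last first.
    by have := normc_ge0 (q - p); lra.
  move=> tt; apply: hr.
  have -> : w t' - w t = (t' - t)%:C * (q - p) by rewrite /w rmorphB/=; ring.
  rewrite Normc.normcM normcR distrC (le_lt_trans _ tt)//.
  by rewrite ler_wpM2l// lerDl.
pose A1 := [set t : R | \forall z \near (w t)^', Q z = 0].
pose A0 := [set t : R | \forall z \near (w t)^', Q z != 0].
have excl t : A1 t -> ~ A0 t.
  move=> /near'_normc[r1 r10 h1] /near'_normc[r2 r20 h2].
  pose u := Num.min r1 r2 / 2.
  have [u0 u1 u2] : [/\ 0 < u, u < r1 & u < r2].
    have a0 : 0 < Num.min r1 r2 by rewrite lt_min r10.
    have a1 : Num.min r1 r2 <= r1 by rewrite ge_min lexx.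
    have a2 : Num.min r1 r2 <= r2 by rewrite ge_min lexx orbT.
    by rewrite /u; split; lra.
  have Nu : N (w t + u%:C - w t) = u by rewrite addrC addKr normcR gtr0_norm.
  have un : w t + u%:C != w t by rewrite -subr_eq0 -normc_eq0 Nu gt_eqF.
  have := h2 _ un; rewrite Nu => /(_ u2); rewrite h1 ?Nu// eqxx.
  by [].
have AE : `[0, 1]%classic `&` A1 = `[0, 1]%classic.
  apply: (@segment_connected R 0 1).
  - exists 1; split; first by rewrite /= in_itv/= ler01 lexx.
    by rewrite /A1/= /w mul1r addrC subrK.
  - by exists A1 => //; exact: wopen.
  (* Along the segment the dichotomy makes [A1] the complement of the open set [A0], hence
     relatively closed. *)
  - exists (~` A0); first by rewrite closedC; exact: wopen.
    apply/seteqP; split=> t [tI hA]; split; [exact: tI|exact: excl hA|exact: tI|].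
    have tI' : 0 <= t <= 1 by move: tI; rewrite /= in_itv.
    case: (dich _ (hD _ tI')) => h0; first exact: h0.
    by case: (hA h0).
have : (`[0, 1]%classic `&` A1) 0 by rewrite AE /= in_itv/= lexx ler01.
by move=> [_]; rewrite /A1/= /w mul0r addr0.
Qed.

Section Continuation.
Variables (h : @spinor R) (F E P : C -> C).
Hypotheses (hE : forall p s, polapprox E p s) (hP : forall p s, polapprox P p s).
Hypothesis hG : forall l, 0 < Im l -> green h l = E l + gamma m l * P l.
Hypothesis hF : meromorphic_continuation m (green h) F.

(* The algebraic equation satisfied by [green h], free of the square root. *)
Let Q (w : C) : C := ((w + m%:C) * (F w - E w)) ^+ 2 - kappa m w * P w ^+ 2.

(** Multiplying [Q] by (z - w)^(2 n) clears the pole of [F] and gives an analytic function, whose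
    zeros are isolated unless it vanishes identically near w. *)
Lemma continuation_dichotomy w : Lambda m w ->
  (\forall z \near w^', Q z = 0) \/ (\forall z \near w^', Q z != 0).
Proof.
move=> /hF.2[n [f [fa /near'_normc[r r0 hf]]]].
pose q (z : C) : C := ((z + m%:C) * (f z - E z * (z - w) ^+ n)) ^+ 2 -
   ((m ^+ 2)%:C - z ^+ 2) * (P z * (z - w) ^+ n) ^+ 2.
have [s s0 fs] := analytic_polapprox fa.
have lin (c : R[i]) : polapprox (fun z : C => z + c) w s.
  by apply: polapprox_ext (polapprox_horner ('X + c%:P) w s) => z _; rewrite !hornerE.
have sq : polapprox (fun z : C => (m ^+ 2)%:C - z ^+ 2) w s.
  by apply: polapprox_ext (polapprox_horner (((m ^+ 2)%:C)%:P - 'X^2) w s) => z _; rewrite !hornerE.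
have qs : polapprox q w s.
  apply: polapproxB; first apply: polapproxX; apply: polapproxM => //.
  - apply: polapproxB => //; apply: polapproxM => //; exact: polapproxX (lin _).
  - by apply: polapproxX; apply: polapproxM => //; exact: polapproxX (lin _).
have qE z : z != w -> N (z - w) < r -> q z = Q z * ((z - w) ^+ n) ^+ 2.
  move=> zw zr; have u0 : (z - w) ^+ n != 0 by rewrite expf_neq0// subr_eq0.
  rewrite /q /Q (hf _ zw zr) /kappa rmorphXn/=.
  by field.
have [[d d0 hd]|[d d0 hd]] := analytic_dichotomy (polapprox_analytic s0 qs); [left|right];
  apply/near'_normc; exists (Num.min d r); try (by rewrite lt_min d0);
  move=> z zw; rewrite lt_min => /andP[zd zr].
  have u0 : (z - w) ^+ n != 0 by rewrite expf_neq0// subr_eq0.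
  have /eqP := hd _ zd; rewrite qE// mulf_eq0 => /orP[/eqP //|].
  by rewrite expf_eq0 (negbTE u0).
have := hd _ zw zd; rewrite qE//.
by apply: contraNneq => ->; rewrite mul0r.
Qed.

Lemma continuation_upper (w : C) : 0 < Im w -> Q w = 0.
Proof.
move=> w0; have FG : F w = E w + gamma m w * P w by rewrite -hG//; exact: hF.1.
rewrite /Q FG [E w + _]addrC addrK mulrA gammaM// exprMn sqrrN.
by rewrite [rho m w ^+ 2]expr2 rho_sqr subrr.
Qed.

Lemma continuation_lower (p : C) : Im p < 0 -> \forall z \near p^', Q z = 0.
Proof.
(* The segment from p to q has midpoint 2 m: it crosses the real axis to the right of the cut and
   ends in C_+. *)
have m1 := m0; move=> p0; pose q : C := (4 * m)%:C - p.
apply: (@punctured_identity (Lambda m) _ p q) => //.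
- exact: continuation_dichotomy.
- move=> t _ [].
  have -> : Im (p + t%:C * (q - p)) = (1 - 2 * t) * Im p.
    by rewrite /q !(ImD, ImM, ReD, ImN, ReN)/=; ring.
  have -> : Re (p + t%:C * (q - p)) = (1 - 2 * t) * Re p + 4 * t * m.
    by rewrite /q !(ImD, ReM, ReD, ImN, ReN)/=; ring.
  move=> /eqP; rewrite mulf_eq0 (lt_eqF p0) orbF => /eqP t2 /andP[_].
  rewrite t2 mul0r add0r => h4.
  have : t = 2^-1 by lra.
  by move=> tE; rewrite tE in h4; lra.
- apply/near'_normc; exists (- Im p); first lra.
  move=> z _ zq; apply: continuation_upper.
  have := le_lt_trans (Im_le_normc _) zq.
  rewrite /q !(ImD, ImN)/= ltr_norml => /andP[]; lra.
Qed.

(** The equation fixes (z + m) (F - E) up to sign, which suffices for its modulus. [Q z = 0] is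
    assumed at the point z itself, since it is known only on punctured neighbourhoods. *)
Lemma continuation_bounded (p : C) : 0 < N (p + m%:C) ->
  exists2 d : R, 0 < d & exists B : R, forall z, N (z - p) <= d -> Q z = 0 -> N (F z) <= B.
Proof.
move=> p0; pose c := N (p + m%:C) / 2; have c0 : 0 < c by rewrite /c; lra.
have [B1 B10 h1] := polapprox_bounded (hE p c).
have [B2 B20 h2] := polapprox_bounded (hP p c).
have [K K0 hK] := kappa_bounded p c.
exists c => //; exists (B1 + (1 + K) * B2 / c) => z zp.
have zc : c <= N (z + m%:C).
  have -> : z + m%:C = (p + m%:C) - (p - z) by ring.
  by have := normc_subl (p + m%:C) (p - z); rewrite normc_distC in zp; rewrite /c in zp *; lra.
move=> /eqP; rewrite subr_eq0 => /eqP Qz.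
have h3 : N (z + m%:C) * N (F z - E z) <= (1 + K) * B2.
  rewrite -(@ler_pXn2r _ 2)// ?nnegrE ?mulr_ge0 ?normc_ge0//; last by lra.
  rewrite -Normc.normcM -normcX Qz Normc.normcM normcX exprMn.
  rewrite ler_pM ?normc_ge0 ?exprn_ge0 ?normc_ge0//.
    by have := hK _ zp; nra.
  by rewrite lerXn2r ?nnegrE ?normc_ge0// h2.
have h4 : N (F z - E z) <= (1 + K) * B2 / c.
  rewrite ler_pdivlMr// (le_trans _ h3)// mulrC ler_wpM2r ?normc_ge0//.
have := normcD (F z - E z) (E z); rewrite subrK.
by have := h1 _ zp; lra.
Qed.

End Continuation.

Lemma no_resonance h (p : C) n F : C0_spinor h -> C_minus p \/ rim m p ->
  meromorphic_continuation m (green h) F -> ~ pole_along C_minus F p n.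
Proof.
have m1 := m0; move=> hC hp hF [F1 [/near_normc[r r0 hF1] hpole]].
have [E [P [hE hP hG]]] := green_decomposition hC.
have pm : 0 < N (p + m%:C).
  rewrite normc_gt0; apply/eqP => h0; case: hp => [hp|[_ /andP[hp _]]].
    by move: hp; rewrite /C_minus/= -[p](addrK m%:C) h0 ImB/= subrr ltxx.
  by move: hp; rewrite -[p](addrK m%:C) h0 ReB/= sub0r ltxx.
have p0 : Im p <= 0.
  by case: hp => [|[-> _]]; [rewrite /C_minus/= => /ltW|].
have [d1 d10 [B hB]] := continuation_bounded F hE hP pm.
have n0 : (0 < n)%N by case: hpole.
suff : (n <= 0)%N by rewrite leqNgt n0.
apply: (@pole_order_le _ _ _ C_minus _ _ B hpole) => d d0.
pose e := Num.min d (Num.min r d1) / 4.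
have [e0 ed er ed1] : [/\ 0 < e, 4 * e <= d, 4 * e <= r & 4 * e <= d1].
  have a0 : 0 < Num.min d (Num.min r d1) by rewrite !lt_min d0 r0.
  have a1 : Num.min d (Num.min r d1) <= d by rewrite !ge_min lexx.
  have a2 : Num.min d (Num.min r d1) <= r by rewrite !ge_min lexx orbT.
  have a3 : Num.min d (Num.min r d1) <= d1 by rewrite !ge_min lexx !orbT.
  by rewrite /e; split; lra.
have q0 : Im (p - 0 +i* e) < 0 by rewrite ImB/=; lra.
have /near'_normc[s s0 hs] := continuation_lower hE hP hG hF q0.
(* [Q] is known to vanish near p - i e, but not at it, where [F] may take any value; a second shift
   downwards reaches a usable point. *)
pose e' := Num.min s e / 2.
have [e'0 e's e'e] : [/\ 0 < e', e' < s & e' < e].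
  have a0 : 0 < Num.min s e by rewrite !lt_min e0 s0.
  have a1 : Num.min s e <= s by rewrite !ge_min lexx.
  have a2 : Num.min s e <= e by rewrite !ge_min lexx orbT.
  by rewrite /e'; split; lra.
pose w : C := p - 0 +i* e - 0 +i* e'.
have wq : N (w - (p - 0 +i* e)) = e'.
  by rewrite /w addrC addKr normcN imaginary_normc// ltW.
have wp : N (w - p) = e + e'.
  have -> : w - p = - (0 +i* (e + e')).
    rewrite /w; have -> : (0 +i* (e + e') : R[i]) = 0 +i* e + 0 +i* e'.
      by apply/eqP; rewrite eq_complex ReD ImD/= addr0 !eqxx.
    by ring.
  by rewrite normcN imaginary_normc// addr_ge0// ltW.
have w0 : C_minus w by rewrite /C_minus/= /w ImB/=; lra.
exists w; split=> //.
- by rewrite -subr_eq0 -normc_eq0 wp gt_eqF// addr_gt0.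
- by rewrite wp; lra.
- rewrite expr0 mulr1 hF1 ?wp//; last lra.
  apply: hB; first by rewrite wp; lra.
  by apply: hs; [rewrite -subr_eq0 -normc_eq0 wq gt_eqF|rewrite wq].
Qed.

End FreeDiracStates.

(** * The simple pole at the lower branch point *)

Section VirtualState.
Variable R : realType.
Local Notation C := (R[i]^o).
Variable m : R.

(* T = 1 - sqrt (1 - k) is the limit of the iteration T := (k + T^2) / 2. *)
Lemma sqrtc_polapprox : 0 < m -> exists2 s, 0 < s &
  polapprox (fun z : C => sqrtc ((2 * m)%:C - z ^+ 2)) 0 s.
Proof.
move=> m0; pose a := Num.sqrt (2 * m).
have a0 : 0 < a by rewrite sqrtr_gt0; lra.
have a2 : a ^+ 2 = 2 * m by rewrite sqr_sqrtr//; lra.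
have aC : a%:C != 0 by rewrite -normc_eq0 normcR gtr0_norm// gt_eqF.
(* Then |z|^2 <= m, so k = z^2 / (2 m) has modulus at most 1/2. *)
pose s := Num.min 1 m; have s0 : 0 < s by rewrite lt_min ltr01.
exists s => //.
pose T (z : C) : C := 1 - sqrtc ((2 * m)%:C - z ^+ 2) / a%:C.
pose k (z : C) : C := z ^+ 2 / (a ^+ 2)%:C.
have TE z : T z = 2^-1 * (k z + T z ^+ 2).
  have h : (sqrtc ((2 * m)%:C - z ^+ 2) / a%:C) ^+ 2 = 1 - k z.
    rewrite expr_div_n sqr_sqrtc -a2 /k rmorphXn/=.
    by field.
  rewrite /T; set u := sqrtc _ / _ in h *.
  have -> : k z = 1 - u ^+ 2 by rewrite h; ring.
  by field.
have kz z : N (z - 0) <= s -> N (k z) <= 2^-1.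
  rewrite subr0 le_min => /andP[z1 zm].
  rewrite /k Normc.normcM Normc.normcV normcX normcR a2 gtr0_norm; last lra.
  rewrite ler_pdivrMr; last lra.
  by have := normc_ge0 z; nra.
have Tz z : N (z - 0) <= s -> N (T z) <= 2^-1.
  move=> /kz hk; apply: le_trans hk.
  pose u := sqrtc ((2 * m)%:C - z ^+ 2) / a%:C.
  have u0 : 0 <= Re u.
    rewrite /u -fmorphV ReM/= mulr0 subr0 mulr_ge0 ?sqrtc_Re_ge0//.
    by rewrite invr_ge0 ltW.
  (* The principal branch enters here: Re u >= 0, and k = T (1 + u) then yields |T| <= |k|. *)
  have u1 : 1 <= N (1 + u).
    apply: le_trans (Re_le_normc _); rewrite ReD/= ger0_norm; lra.
  have -> : k z = T z * (1 + u).
    have h : u ^+ 2 = 1 - k z.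
      rewrite /u expr_div_n sqr_sqrtc -a2 /k rmorphXn/=.
      by field.
    have -> : k z = 1 - u ^+ 2 by rewrite h; ring.
    by rewrite /T -/u; ring.
  by rewrite Normc.normcM ler_peMr ?normc_ge0.
(* Keeping |P| <= 1/2 gives |T + P| <= 1, so each iteration halves the error (T - P) (T + P) / 2. *)
have key n : exists P : {poly R[i]}, forall z, N (z - 0) <= s ->
    N P.[z] <= 2^-1 /\ N (T z - P.[z]) <= 2^-1 ^+ n.
  elim: n => [|n [P hP]].
    exists 0 => z zs; rewrite horner0 Normc.normc0 subr0 expr0; split=> //.
    by apply: le_trans (Tz _ zs) _; rewrite invf_le1// ler1n.
  exists ((2^-1)%:P * (((a ^+ 2)%:C^-1)%:P * 'X^2 + P ^+ 2)) => z zs.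
  have [h1 h2] := hP z zs; have h3 := Tz _ zs; have h4 := kz _ zs.
  have hE : ((2^-1)%:P * (((a ^+ 2)%:C^-1)%:P * 'X^2 + P ^+ 2)).[z] =
     2^-1 * (k z + P.[z] ^+ 2).
    by rewrite hornerM hornerC hornerD hornerM hornerC hornerXn horner_exp /k mulrC [z ^+ 2 / _]mulrC mulrC.
  have N2 : N (2^-1 : R[i]) = 2^-1.
    by rewrite Normc.normcV -(rmorph_nat (real_complex R)) normcR ger0_norm.
  rewrite hE; split.
    rewrite Normc.normcM N2.
    have := normcD (k z) (P.[z] ^+ 2); rewrite normcX.
    by have := normc_ge0 P.[z]; nra.
  rewrite TE -mulrBr.
  have -> : k z + T z ^+ 2 - (k z + P.[z] ^+ 2) = (T z - P.[z]) * (T z + P.[z]) by ring.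
  rewrite !Normc.normcM N2 exprS ler_wpM2l// -[leRHS]mulr1.
  rewrite ler_pM ?normc_ge0// (le_trans (normcD _ _))//; lra.
have TP : polapprox T 0 s.
  move=> e e0.
  have [n hn] : exists n, 1 < e * n.+1%:R.
    by exists (Num.trunc (1 / e)); rewrite [e * _]mulrC -ltr_pdivrMr// truncnS_gt.
  have [P hP] := key n; exists P => z zs; have [_ h2] := hP z zs.
  apply: (le_trans h2); rewrite exprVn -[leLHS]mul1r ler_pdivrMr ?exprn_gt0//.
  rewrite ltW// (lt_le_trans hn)//.
  by rewrite ler_wpM2l ?(ltW e0)// -natrX ler_nat; exact: ltn_expl.
apply: polapprox_ext (polapproxM (polapprox_cst a%:C 0 s)
  (polapproxB (polapprox_cst 1 0 s) TP)) => z _.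
by rewrite /T opprB addrC subrK mulrC divfK.
Qed.

(** Second component of the test data: the residue at - m is nonzero as soon as its integral is,
    here 1/2. *)
Definition tent (x : R) : R := Num.max (1 - x) 0.

Lemma tent_continuous : continuous tent.
Proof.
move=> x; apply: (@continuous_max _ _ (fun x : R => 1 - x : R^o) (cst 0)); last exact: cvg_cst.
by apply: cvgB; [exact: cvg_cst|exact: cvg_id].
Qed.

Definition tent_spinor : @spinor R := (fun=> 0, fun x => (tent x)%:C).

Lemma tent_ccont : ccont tent_spinor.2.
Proof. exact: ccont_real tent_continuous. Qed.

Lemma tent_far x : 1 < x -> tent x = 0.
Proof. by move=> x1; rewrite /tent max_r//; lra. Qed.

Lemma ccont_continuous (f : R -> R[i]) : ccont f -> continuous (f : R -> C).
Proof.
move=> [f1 f2] x A /near_normc[r r0 hA].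
have r2 : 0 < r / 2 by lra.
have /cvgrPdist_lt /(_ _ r2) h1 := f1 x; have /cvgrPdist_lt /(_ _ r2) h2 := f2 x.
change (nbhs x (f @^-1` A)); apply: filterS2 h1 h2 => t t1 t2.
apply: hA; rewrite normc_distC (le_lt_trans (normc_le_ReIm _))// ReB ImB.
lra.
Qed.

Lemma tent_spinor_C0 : C0_spinor tent_spinor.
Proof.
split; first by apply: continuous_subspaceT => x; exact: cvg_cst.
  by apply: continuous_subspaceT; exact: ccont_continuous tent_ccont.
by exists 1 => x x1; split => //; rewrite /tent_spinor/= tent_far.
Qed.

Lemma tent_spinor_neq0 : nonzero_spinor tent_spinor.
Proof.
exists 0 => //; right; rewrite /tent_spinor/= /tent subr0 max_l//.
exact: oner_neq0.
Qed.

Lemma rprim_tent : rprim tent 1 = 2^-1.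
Proof.
pose F (x : R) : R := x - 2^-1 * (x * x).
have cF : continuous F.
  move=> x; apply: cvgB; first exact: cvg_id.
  by apply: cvgM; [exact: cvg_cst|apply: cvgM; exact: cvg_id].
have cf : continuous (fun x : R => 1 - x).
  by move=> x; apply: cvgB; [exact: cvg_cst|exact: cvg_id].
have dF (y : R) : 0 < y -> is_derive y 1 F (1 - y).
  move=> _; have d1 : is_derive y 1 (id : R -> R) 1 by exact: is_derive_id.
  have d2 : is_derive y 1 ((id : R -> R) * (id : R -> R))%R (y *: 1 + y *: 1).
    exact: is_deriveM.
  have -> : F = ((id : R -> R) - (cst 2^-1 : R -> R) * ((id : R -> R) * (id : R -> R)))%R.
    exact/funext.
  apply: (is_deriveE (is_deriveB d1 (is_deriveM (is_derive_cst (2^-1 : R) y 1) d2))).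
  by rewrite /GRing.scale/=; field.
have := rprim_FTC2 cF cf dF ler01.
rewrite {1 2}/F !mulr1 !mulr0 subrr add0r => h.
have -> : rprim tent 1 = rprim (fun x => 1 - x) 1.
  by apply: rprim_eq => y /andP[_ y1]; rewrite /tent max_l// subr_ge0.
by rewrite -h; field.
Qed.

Lemma rho_bottom : rho m (- m%:C) = 0.
Proof. by rewrite /rho /kappa sqrrN subrr sqrtc0. Qed.

(** At l = - m both l + m and [rho] vanish, so phi is the constant (0, 1) and pairing with it
    integrates the second component. *)
Lemma rank_one_bottom : rank_one_part m (fun=> 0) tent_spinor.2 1 (- m%:C) != 0.
Proof.
have phiE k1 k2 : phi_int m k1 k2 (- m%:C) 1 = cprim k2 1.
  apply: cprim_eq => y _; rewrite /dpair /phi1 addNr !mul0r add0r.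
  rewrite /phi2 /dcosh rho_bottom oppr0 !mul0r cexp0.
  by field.
have hR : Re (cprim tent_spinor.2 1) = 2^-1 by exact: rprim_tent.
have half : cprim tent_spinor.2 1 != 0.
  by apply/eqP => h; move: hR; rewrite h/= => /eqP; rewrite eq_sym invr_eq0 pnatr_eq0.
rewrite /rank_one_part !phiE mulf_neq0//.
have -> : cprim (fun x => (tent_spinor.2 x)^*) 1 = cprim tent_spinor.2 1.
  by apply: cprim_eq => y _; rewrite /tent_spinor/=; apply/eqP; rewrite eq_complex/= oppr0 !eqxx.
exact: half.
Qed.

(** Both sides have the same square, so only the sign is at stake. The root r has Re r >= 0 and Im
    r^2 = - Im z^2 < 0, hence Im r < 0 and Re (z r) > 0, as for [rho]. *)
Lemma rho_first_quadrant (z : C) : 0 < m -> first_quadrant z ->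
  rho m (- m%:C + z ^+ 2) = z * sqrtc ((2 * m)%:C - z ^+ 2).
Proof.
move=> m0 [x0 y0]; set r := sqrtc _; set l := - m%:C + z ^+ 2.
have l0 : 0 < Im l.
  rewrite /l ImD/= oppr0 add0r expr2 ImM.
  by rewrite addr_gt0 ?mulr_gt0.
have rR : 0 <= Re r by exact: sqrtc_Re_ge0.
have rI : 2 * (Re r * Im r) = - (2 * (Re z * Im z)).
  have : Im (r ^+ 2) = Im ((2 * m)%:C - z ^+ 2) by rewrite sqr_sqrtc.
  rewrite ImB !expr2 !ImM/= [Im r * _]mulrC [Im z * _]mulrC sub0r => h.
  by rewrite !mulr_natl !mulr2n h.
have zr : 0 < Re (z * r).
  rewrite ReM; move: x0 y0 rR rI; move: (Re z) (Im z) (Re r) (Im r) => a b c d a0 b0 c0 cd.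
  have ab : 0 < a * b by exact: mulr_gt0.
  have d0 : d < 0 by rewrite ltNge; apply/negP => d0; have := mulr_ge0 c0 d0; lra.
  have := mulr_ge0 (ltW a0) c0.
  have : 0 < b * - d by rewrite mulr_gt0// oppr_gt0.
  by rewrite mulrN; lra.
have := rho_Re_gt0 m0 l0.
have : rho m l ^+ 2 = (z * r) ^+ 2.
  rewrite expr2 rho_sqr exprMn sqr_sqrtc kappaE /l rmorphM rmorph_nat.
  by ring.
move=> /eqP; rewrite eqf_sqr => /orP[/eqP //|/eqP ->].
by rewrite ReN oppr_gt0 => /(lt_trans zr); rewrite ltxx.
Qed.

Lemma virtual_state_bottom : 0 < m ->
  pole_along first_quadrant (fun z => green m tent_spinor (- m%:C + z ^+ 2)) 0 1.
Proof.
move=> m0.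
pose E := regular_part m (fun=> 0) tent_spinor.2 1.
pose P := rank_one_part m (fun=> 0) tent_spinor.2 1.
have ck1 : ccont (fun _ : R => 0 : R[i]) by exact: ccont_cst.
have ck2 := tent_ccont.
have hE p s : polapprox (E : C -> C) p s by exact: regular_part_polapprox.
have hP p s : polapprox (P : C -> C) p s by exact: rank_one_part_polapprox.
have hG l : 0 < Im l -> green m tent_spinor l = E l + gamma m l * P l.
  by apply: resolvent_formE => // x x1; rewrite /tent_spinor/= tent_far.
(* This is z G after inserting gamma = - sqrt(2 m - z^2) / z; its value at 0 is - sqrt(2 m) P(-
   m). *)
pose f (z : C) : C := z * E (- m%:C + z ^+ 2) -
  sqrtc ((2 * m)%:C - z ^+ 2) * P (- m%:C + z ^+ 2).
exists (fun z => f z / z); split.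
  apply/near_normc; exists 1 => // z _ fq; have [x0 y0] := fq.
  have z0 : z != 0 by apply/eqP => h; rewrite h ltxx in x0.
  have l0 : 0 < Im (- m%:C + z ^+ 2).
    by rewrite ImD/= oppr0 add0r expr2 ImM addr_gt0 ?mulr_gt0.
  rewrite hG// /gamma rho_first_quadrant// addrAC addNr add0r /f.
  by field.
split=> //; exists f; split.
- have [s s0 hs] := sqrtc_polapprox m0.
  apply: (polapprox_analytic s0).
  have comp (D : C -> C) : (forall p t, polapprox D p t) ->
      polapprox (fun z : C => D (- m%:C + z ^+ 2)) 0 s.
    move=> hD.
    have [B _ hB] := normc_horner_le ('X^2 - (m%:C)%:P) (ltW s0).
    apply: polapprox_ext (@polapprox_comp _ D 0 B ('X^2 - (m%:C)%:P) 0 s (hD 0 B) _) => z.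
      by move=> _; rewrite !hornerE [- _ + _]addrC.
    by rewrite !subr0; exact: hB.
  apply: polapproxB; apply: polapproxM; [|exact: comp|exact: hs|exact: comp].
  by apply: polapprox_ext (polapprox_horner 'X 0 s) => z _; rewrite hornerX.
- have r0 : sqrtc (2 * m)%:C != 0 :> R[i].
    by rewrite sqrtc_eq0 -normc_eq0 normcR normr_eq0 gt_eqF//; lra.
  rewrite /f mul0r sub0r oppr_eq0 expr2 mulr0 subr0 addr0.
  by apply: mulf_neq0; [exact: r0|exact: rank_one_bottom].
- by apply/near'_normc; exists 1 => // z _ _; rewrite subr0 expr1.
Qed.

End VirtualState.

Theorem proposition1p1 (R : realType) (m : R) (hm : 0 < m) :
  (forall (k : state_kind) (lambda0 : R[i]),
     is_state m (free_dirac m) k lambda0 <->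
     k = VirtualState /\ lambda0 = - m%:C) /\
  simple_state m (free_dirac m) VirtualState (- m%:C).
Proof.
have ex : state_pole_order m (free_dirac m) VirtualState (- m%:C) 1.
  exists (tent_spinor R); split; [exact: tent_spinor_C0|exact: tent_spinor_neq0|].
  by split; [right|exact: virtual_state_bottom].
split=> [k l|]; last first.
  split=> // n' [h [hC _ [_ hp]]].
  exact: (virtual_state_bottom_order hm hC hp).
split=> [[n [h [hC _]]]|[-> ->]]; last by exists 1%N.
case: k => /=.
- by move=> [lr] /(no_eigenvalue hm hC lr).
- by move=> [lr [F [hF]]] /(no_resonance hm hC lr hF).
- move=> [[->|-> _ //] hp].
  by have := no_virtual_state_top hm hC hp.
Qed.
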